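(* Let $\nu\ge0$ be an integer, $V_4>0$ and $\Phi>0$. Let $(\xi_{Ln})_n$ and $(\xi_{Rn})_n$ be (finite or countably infinite) families of positive random variables on a common probability space, with expectation denoted $\langle\cdot\rangle_\nu$. Suppose there is a nonzero constant $c$ such that for all real $j_L,j_R$ $$(-j_Lj_R)^\nu\Big\langle\prod_n\Big(1+\frac{j_L^2}{\xi_{Ln}^2}\Big)\prod_n\Big(1+\frac{j_R^2}{\xi_{Rn}^2}\Big)\Big\rangle_\nu=c\,Z^{\rm eff}_\nu(j_L,j_R),$$ the expectation on the left being finite, where $$Z^{\rm eff}_\nu(j_L,j_R)=\int_0^{2\pi}\frac{d\theta}{2\pi}\int_{\mathrm U(1)}dV\,\exp\Big[-i\nu\theta-2V_4\Phi\,\mathrm{Re}\big((j_Le^{-i\theta/2}-j_Re^{i\theta/2})V\big)\Big]$$ with normalized Haar measure $dV$. Then $Z^{\rm eff}_\nu(j_L,j_R)=I_\nu(-2V_4\Phi j_L)\,I_\nu(2V_4\Phi j_R)$, where $I_\nu$ is the modified Bessel function of the first kind, and $$\Big\langle\sum_n\frac1{\xi_{Rn}^2}\Big\rangle_\nu=\Big\langle\sum_n\frac1{\xi_{Ln}^2}\Big\rangle_\nu=\frac{(V_4\Phi)^2}{\nu+1},\qquad \Big\langle\Big(\sum_m\frac1{\xi_{Rm}^2}\Big)\Big(\sum_n\frac1{\xi_{Ln}^2}\Big)\Big\rangle_\nu=\frac{(V_4\Phi)^4}{(\nu+1)^2},$$ $$\Big\langle\sum_{m<n}\frac1{\xi_{Rm}^2\xi_{Rn}^2}\Big\rangle_\nu=\Big\langle\sum_{m<n}\frac1{\xi_{Lm}^2\xi_{Ln}^2}\Big\rangle_\nu=\frac{(V_4\Phi)^4}{2(\nu+1)(\nu+2)}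 .$$
   Context: In the source, this is the case of $N_f=2$ flavors: $\xi_{Ln},\xi_{Rn}$ are the nonzero left- and right-handed singular values of the Dirac operator of massless two-color QCD in space-time volume $V_4$ at intermediate density, $j_L,j_R$ are diquark sources, $\Phi$ is the diquark condensate parameter, $\langle\cdot\rangle_\nu$ is the average over gauge fields of topological charge $\nu$ weighted by the nonzero-mode fermion determinant, and $Z^{\rm eff}_\nu$ is the finite-volume (epsilon-regime) partition function of the effective theory projected to topological charge $\nu$. *)

(* Defs.v *)
From HB Require Import structures.
From mathcomp Require Import all_boot all_order all_algebra.
From mathcomp Require Import complex.
From mathcomp Require Import all_classical all_reals all_analysis.

Set Implicit Arguments.
Unset Strict Implicit.
Unset Printing Implicit Defensive.

Import Order.TTheory GRing.Theory Num.Theory.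
Import numFieldNormedType.Exports.

Local Open Scope classical_set_scope.
Local Open Scope ring_scope.
Local Open Scope complex_scope.

(* I_nu(z) = \sum_k (z/2)^(2k+nu) / (k! Gamma(k+nu+1)), for an integer order
   nu >= 0. *)
Definition besselI_coeff (R : realType) (nu : nat) (z : R) (k : nat) : R :=
  (z / 2) ^+ (2 * k + nu) / (k`! * (k + nu)`!)%:R.

Definition besselI (R : realType) (nu : nat) (z : R) : R :=
  limn (series (besselI_coeff nu z)).

Definition cexp (R : realType) (z : R[i]) : R[i] :=
  (expR (complex.Re z))%:C *
  (cos (complex.Im z) +i* sin (complex.Im z)).

Definition Cintegral d (T : measurableType d) (R : realType)
    (mu : {measure set T -> \bar R}) (D : set T) (f : T -> R[i]) : R[i] :=
  Rintegral mu D (fun x => complex.Re (f x)) +i*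
  Rintegral mu D (fun x => complex.Im (f x)).

Definition U1 (R : realType) : Type := {z : R[i] | `|z| == 1}.

HB.instance Definition _ (R : realType) := Choice.on (U1 R).

Definition U1_one (R : realType) : U1 R :=
  exist _ 1 (introT eqP (normr1 R[i])).

HB.instance Definition _ (R : realType) := isPointed.Build (U1 R) (U1_one R).

Lemma U1_mul_subproof (R : realType) (u v : U1 R) :
  `|sval u * sval v| == 1.
Proof.
by case: u v => [u /= /eqP u1] [v /= /eqP v1]; rewrite normrM u1 v1 mulr1.
Qed.

Definition U1_mul (R : realType) (u v : U1 R) : U1 R :=
  exist _ (sval u * sval v) (U1_mul_subproof u v).

Definition U1_coord (R : realType) (u : U1 R) : R * R :=
  (complex.Re (sval u), complex.Im (sval u)).

(* The Borel sigma-algebra of U(1), as a subspace of C = R^2. *)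
HB.instance Definition _ (R : realType) :=
  Measurable.copy (U1 R) (g_sigma_algebra_preimageType (@U1_coord R)).

(* The normalization is part of the type of [mu]; U(1) being compact, these
   conditions single out one measure. *)
Definition is_haar_U1 (R : realType) (mu : probability (U1 R) R) : Prop :=
  forall (u : U1 R) (A : set (U1 R)), measurable A ->
    mu (U1_mul u @^-1` A) = mu A.

Definition Zeff_integrand (R : realType) (nu : nat) (V4 Phi jL jR theta : R)
    (V : U1 R) : R[i] :=
  cexp (- 'i * (nu%:R * theta)%:C -
        (2 * V4 * Phi * complex.Re
          ((jL%:C * cexp (- 'i * (theta / 2)%:C) -
            jR%:C * cexp ('i * (theta / 2)%:C)) * sval V))%:C).

Definition Zeff (R : realType) (dV : probability (U1 R) R) (nu : nat)
    (V4 Phi jL jR : R) : R[i] :=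
  Cintegral (@lebesgue_measure R) `[0, 2 * pi]
    (fun theta => (2 * pi)^-1%:C *
       Cintegral dV setT (Zeff_integrand nu V4 Phi jL jR theta)).

(* \prod_(n in D) (1 + j^2 / xi_n^2) as an extended real: the partial products
   are nondecreasing, so the limit exists in [0, +oo]. *)
Definition detprod (R : realType) (D : set nat) (xi : nat -> R) (j : R)
    : \bar R :=
  limn (fun N => (\prod_(0 <= n < N | n \in D) (1 + j ^+ 2 / xi n ^+ 2))%:E).

Definition sum_inv2 (R : realType) (D : set nat) (xi : nat -> R) : \bar R :=
  (\esum_(n in D) ((xi n ^+ 2)^-1)%:E)%E.

Definition sum_inv4 (R : realType) (D : set nat) (xi : nat -> R) : \bar R :=
  (\esum_(p in [set p : nat * nat | [/\ D p.1, D p.2 & (p.1 < p.2)%N]])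
     ((xi p.1 ^+ 2 * xi p.2 ^+ 2)^-1)%:E)%E.

(* Main.v *)
Require Import Defs.
From HB Require Import structures.
From mathcomp Require Import all_boot all_order all_algebra.
From mathcomp Require Import complex zify ring lra.
From mathcomp Require Import all_classical all_reals all_analysis.
From mathcomp Require Import measurable_realfun.

Set Implicit Arguments.
Unset Strict Implicit.
Unset Printing Implicit Defensive.

Import Order.TTheory GRing.Theory Num.Theory.
Import numFieldNormedType.Exports.

Local Open Scope classical_set_scope.
Local Open Scope ring_scope.
Local Open Scope complex_scope.

(** Partition function: by invariance of the Haar measure, [V] may be replaced
    by [e^(i theta/2) V], which turns the exponent into
    [- a jL Re V + a jR Re (e^(i theta) V)] with [a = 2 V4 Phi]. After Fubini,
    both integrals are averages over the circle of
    [conj(u)^nu exp (b Re (u v))]. Such an average depends only on the moments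
    [<u^m conj(u)^n> = delta_mn]: expanding the exponential and then
    [Re (u v)^n] by the binomial theorem gives [v^nu I_nu(b)].

    Sum rules: with [s_n = 1/xi_n^2], elementary symmetric functions [e1], [e2]
    and [L(x) = \prod_n (1 + x s_n)],
    [1 + e1 x + e2 x^2 <= L(x) <= 1 + e1 x + e2 x^2 + x^3 L(1)] on [[0, 1]].
    Hence the expectation of [L(x) R(y)] has an expansion with cubic error
    [O(x^3)] on each ray [y = k x], with no exchange of limits. It equals
    [K f(x) f(y)] for [x, y > 0], where [f] is [I_nu] stripped of its leading
    power; comparing coefficients gives [K = 1] and the sum rules. *)

(** * Infinite products with nonnegative terms *)

(** The remainder is a polynomial in [x] with nonnegative coefficients and no term below degree 3,
    so on [0, 1] it is at most [x ^+ 3] times its value at 1. The induction carries this comparison: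
    a new factor [1 + x * a] turns a remainder [r] into [r + x * a * r + x ^+ 3 * (a * e2)]. *)
Lemma prod1D_taylor2 (R : realFieldType) (s : nat -> R) (x : R) (N : nat) :
  (forall n, 0 <= s n) -> 0 <= x <= 1 ->
  let e1 := \sum_(0 <= n < N) s n in
  let e2 := \sum_(0 <= n < N) s n * \sum_(0 <= m < n) s m in
  0 <= \prod_(0 <= n < N) (1 + x * s n) - (1 + e1 * x + e2 * x ^+ 2) /\
  \prod_(0 <= n < N) (1 + x * s n) - (1 + e1 * x + e2 * x ^+ 2) <=
  x ^+ 3 * (\prod_(0 <= n < N) (1 + 1 * s n) - (1 + e1 + e2)).
Proof.
move=> s0 /andP[x0 x1]; elim: N => [|N /= [IH1 IH2]].
  by rewrite /= !big_geq// !mul0r !addr0 subrr mulr0.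
rewrite /= !big_nat_recr//=.
have E1 : 0 <= \sum_(0 <= n < N) s n by apply: sumr_ge0.
have E2 : 0 <= \sum_(0 <= n < N) s n * \sum_(0 <= m < n) s m.
  by apply: sumr_ge0 => i _; rewrite mulr_ge0// sumr_ge0.
move: (s0 N) IH1 IH2 E1 E2.
move: (s N) (\sum_(0 <= n < N) s n) (\prod_(0 <= n < N) (1 + x * s n))
  (\prod_(0 <= n < N) (1 + 1 * s n))
  (\sum_(0 <= n < N) s n * \sum_(0 <= m < n) s m) => a e1 p q e2 a0 IH1 IH2 E1 E2.
have x30 : 0 <= x ^+ 3 by rewrite exprn_ge0.
set r := p - _ in IH1 IH2; have pE : p = r + (1 + e1 * x + e2 * x ^+ 2).
  by rewrite /r subrK.
set r' := q - _ in IH2; have qE : q = r' + (1 + e1 + e2).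
  by rewrite /r' subrK.
have xa0 : 0 <= x * a by rewrite mulr_ge0.
have h1 : 0 <= x * a * r by rewrite mulr_ge0.
have h2 : 0 <= x ^+ 3 * (a * e2) by rewrite !mulr_ge0.
(* The bound [x <= 1] removes the spare power of [x] before the induction hypothesis is applied. *)
have h3 : x * a * r <= a * (x ^+ 3 * r').
  apply: le_trans (_ : a * r <= _); last by rewrite ler_wpM2l.
  rewrite ler_wpM2r//; by rewrite ler_piMl.
rewrite pE qE; split.
  suff -> : (r + (1 + e1 * x + e2 * x ^+ 2)) * (1 + x * a) -
    (1 + (e1 + a) * x + (e2 + a * e1) * x ^+ 2) =
    r + x * a * r + x ^+ 3 * (a * e2) by lra.
  ring.
suff -> : (r + (1 + e1 * x + e2 * x ^+ 2)) * (1 + x * a) -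
    (1 + (e1 + a) * x + (e2 + a * e1) * x ^+ 2) =
    r + x * a * r + x ^+ 3 * (a * e2); last by ring.
suff -> : x ^+ 3 * ((r' + (1 + e1 + e2)) * (1 + 1 * a) -
   (1 + (e1 + a) + (e2 + a * e1))) =
   x ^+ 3 * r' + a * (x ^+ 3 * r') + x ^+ 3 * (a * e2) by lra.
by ring.
Qed.

Definition eprod1D (R : realType) (s : nat -> R) (x : R) : \bar R :=
  limn (fun N => (\prod_(0 <= n < N) (1 + x * s n))%:E).

Definition esym1 (R : realType) (s : nat -> R) : \bar R :=
  (\sum_(n <oo) (s n)%:E)%E.

(** The second elementary symmetric function, each pair [m < n] being listed under its larger index;
    all terms are nonnegative for nonnegative [s]. *)
Definition esym2 (R : realType) (s : nat -> R) : \bar R :=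
  (\sum_(n <oo) (s n * \sum_(0 <= m < n) s m)%:E)%E.

Section sequence.
Variables (R : realType) (s : nat -> R).
Hypothesis s0 : forall n, 0 <= s n.

Lemma prod1D_ge1 x N : 0 <= x -> 1 <= \prod_(0 <= n < N) (1 + x * s n).
Proof.
move=> x0; elim: N => [|N IH]; first by rewrite big_geq.
rewrite big_nat_recr//= -[X in X <= _]mulr1 ler_pM// lerDl mulr_ge0//.
Qed.

Lemma nondecreasing_prod1D x : 0 <= x ->
  nondecreasing_seq (fun N => \prod_(0 <= n < N) (1 + x * s n)).
Proof.
move=> x0; apply/nondecreasing_seqP => N; rewrite big_nat_recr//=.
by rewrite ler_peMr// ?lerDl ?mulr_ge0// (le_trans ler01)// prod1D_ge1.
Qed.

Lemma is_cvg_eprod1D x : 0 <= x ->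
  cvgn (fun N => (\prod_(0 <= n < N) (1 + x * s n))%:E).
Proof.
move=> x0; apply: ereal_nondecreasing_is_cvgn => m n mn.
by rewrite lee_fin; exact: nondecreasing_prod1D.
Qed.

Lemma eprod1D_ub x N : 0 <= x ->
  ((\prod_(0 <= n < N) (1 + x * s n))%:E <= eprod1D s x)%E.
Proof.
move=> x0; rewrite /eprod1D.
have ndp : nondecreasing_seq (fun N => (\prod_(0 <= n < N) (1 + x * s n))%:E).
  by move=> m n mn; rewrite lee_fin; exact: nondecreasing_prod1D.
rewrite (cvg_lim _ (ereal_nondecreasing_cvgn ndp))//.
by apply: ereal_sup_ubound; exists N.
Qed.

Lemma eprod1D_ge1 x : 0 <= x -> (1 <= eprod1D s x)%E.
Proof.
by move=> x0; apply: le_trans (eprod1D_ub 0 x0); rewrite big_geq.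
Qed.

(** Finiteness at 1 bounds the partial products, hence the partial sums of both symmetric functions,
    and monotone convergence makes all limits real. The finite inequalities then pass to the
    limit. *)
Lemma eprod1D_taylor2 : (eprod1D s 1 < +oo)%E ->
  exists e1 e2 : R, exists l : R -> R,
  [/\ esym1 s = e1%:E, esym2 s = e2%:E, 0 <= e1, 0 <= e2 &
    forall x, 0 <= x <= 1 -> eprod1D s x = (l x)%:E /\
      0 <= l x - (1 + e1 * x + e2 * x ^+ 2) <= x ^+ 3 * l 1].
Proof.
move=> Loo.
have Lfin : eprod1D s 1 \is a fin_num.
  by rewrite ge0_fin_numE// (le_trans _ (eprod1D_ge1 ler01)).
set B := fine (eprod1D s 1).
pose p x N := \prod_(0 <= n < N) (1 + x * s n).
pose e1 N := \sum_(0 <= n < N) s n.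
pose e2 N := \sum_(0 <= n < N) s n * \sum_(0 <= m < n) s m.
have p1B N : p 1 N <= B.
  by rewrite -lee_fin /B fineK//; exact: eprod1D_ub.
have px1 x N : 0 <= x <= 1 -> p x N <= p 1 N.
  move=> /andP[x0 x1]; apply: ler_prod => i _.
  by rewrite addr_ge0 ?mulr_ge0//= lerD2l ler_wpM2r.
have e1_ge0 N : 0 <= e1 N by apply: sumr_ge0.
have e2_ge0 N : 0 <= e2 N.
  by apply: sumr_ge0 => i _; rewrite mulr_ge0// sumr_ge0.
have e12B N : 1 + e1 N + e2 N <= B.
  apply: le_trans (p1B N).
  have /= [] := @prod1D_taylor2 _ s 1 N s0; first by rewrite ler01 lexx.
  by rewrite expr1n !mulr1 subr_ge0.
have cp x : 0 <= x <= 1 -> cvgn (p x).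
  move=> x01; apply: nondecreasing_is_cvgn.
    by apply: nondecreasing_prod1D; case/andP: x01.
  by exists B => _ [N _ <-]; apply: le_trans (p1B N); exact: px1.
have ce1 : cvgn e1.
  apply: nondecreasing_is_cvgn.
    by apply/nondecreasing_seqP => N; rewrite /e1 big_nat_recr//= lerDl.
  by exists B => _ [N _ <-]; move: (e12B N) (e1_ge0 N) (e2_ge0 N); lra.
have ce2 : cvgn e2.
  apply: nondecreasing_is_cvgn.
    apply/nondecreasing_seqP => N; rewrite /e2 big_nat_recr//= lerDl.
    by rewrite mulr_ge0// sumr_ge0.
  by exists B => _ [N _ <-]; move: (e12B N) (e1_ge0 N) (e2_ge0 N); lra.
exists (limn e1), (limn e2), (fun x => limn (p x)); split.
- rewrite /esym1 -EFin_lim//; congr (limn _); apply/funext => N /=.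
  by rewrite sumEFin.
- rewrite /esym2 -EFin_lim//; congr (limn _); apply/funext => N /=.
  by rewrite sumEFin.
- by apply: limr_ge => //; near=> N.
- by apply: limr_ge => //; near=> N.
move=> x x01; split; first by rewrite /eprod1D -EFin_lim//; exact: cp.
have cq : (fun N => p x N - (1 + e1 N * x + e2 N * x ^+ 2)) @ \oo -->
    limn (p x) - (1 + limn e1 * x + limn e2 * x ^+ 2).
  apply: cvgB; first exact: cp.
  by apply: cvgD; [apply: cvgD; [exact: cvg_cst|]|]; apply: cvgMl.
have c1 : (fun N => x ^+ 3 * p 1 N) @ \oo --> x ^+ 3 * limn (p 1).
  by apply: cvgMr; apply: cp; rewrite ler01 lexx.
have tay N := @prod1D_taylor2 _ s x N s0 x01.
apply/andP; split.
  rewrite -(cvg_lim _ cq)//; apply: limr_ge; first by apply/cvg_ex; eexists; exact: cq.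
  by near=> N; have [] := tay N.
apply: (ler_cvg_to cq c1); near=> N.
(* The remainder at 1 is weakened to the whole product at 1 by dropping the nonnegative
   [1 + e1 N + e2 N]. *)
have /= [_ /le_trans] := tay N; apply.
rewrite ler_wpM2l//; first by rewrite exprn_ge0//; case/andP: x01.
by rewrite lerBlDr lerDl addr_ge0// ?addr_ge0 ?e1_ge0 ?e2_ge0.
Unshelve. all: by end_near.
Qed.

End sequence.

(** * Comparison of quadratic expansions with cubic error *)

Lemma eq0_of_le_linear (R : realFieldType) (a C : R) :
  (forall t, 0 < t <= 1 -> `|a| <= C * t) -> a = 0.
Proof.
move=> h; apply/normr0_eq0/eqP; rewrite -[_ == _]negbK; apply/negP => a0.
have {a0} a0 : 0 < `|a| by rewrite lt_def a0 normr_ge0.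
have C0 : 0 < C.
  by have := h 1; rewrite ltr01 lexx mulr1 => /(_ isT); exact: lt_le_trans.
have aC : `|a| <= C by have := h 1; rewrite ltr01 lexx mulr1 => /(_ isT).
(* This point lies in (0, 1] because [|a| <= C], and there the hypothesis reads [|a| <= |a| / 2]. *)
have := h (`|a| / (2 * C)).
rewrite divr_gt0 ?mulr_gt0//= ler_pdivrMr ?mulr_gt0// mul1r.
have -> : C * (`|a| / (2 * C)) = `|a| / 2 by field; rewrite gt_eqF.
by move=> /(_ ltac:(lra)); lra.
Qed.

(** The coefficients are eliminated in order of degree: once the lower ones vanish, dividing by the
    leading power of [t] leaves a linear bound on the next. This identifies Taylor coefficients
    without differentiating. *)
Lemma quadratic_eq0_of_le_cubic (R : realFieldType) (a b c M : R) :
  (forall t, 0 < t <= 1 -> `|a + b * t + c * t ^+ 2| <= M * t ^+ 3) ->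
  [/\ a = 0, b = 0 & c = 0].
Proof.
move=> h; have M0 : 0 <= M.
  have := h 1; rewrite ltr01 lexx !expr1n !mulr1 => /(_ isT).
  exact: le_trans (normr_ge0 _).
have a0 : a = 0.
  apply: (@eq0_of_le_linear _ _ (`|b| + `|c| + M)) => t /[dup] /h + /andP[t0 t1].
  have t2t : t ^+ 2 <= t by rewrite expr2 ler_piMl// ltW.
  have t3t : t ^+ 3 <= t.
    by rewrite exprS (le_trans _ t2t)// expr2 ler_pM// ltW// mulr_gt0.
  move=> hh; have -> : a = (a + b * t + c * t ^+ 2) - b * t - c * t ^+ 2 by ring.
  rewrite (le_trans (ler_normB _ _))// (le_trans (lerD (ler_normB _ _) (lexx _)))//.
  rewrite (normrM b) (normrM c) (ger0_norm (ltW t0)) (ger0_norm (exprn_ge0 2 (ltW t0))).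
  have := normr_ge0 b; have := normr_ge0 c; nra.
have b0 : b = 0.
  apply: (@eq0_of_le_linear _ _ (`|c| + M)) => t /[dup] /h + /andP[t0 t1].
  rewrite a0 add0r; have -> : b * t + c * t ^+ 2 = t * (b + c * t) by ring.
  rewrite normrM (ger0_norm (ltW t0)).
  have -> : M * t ^+ 3 = t * (M * t ^+ 2) by ring.
  rewrite ler_pM2l// => hh.
  have t2t : t ^+ 2 <= t by rewrite expr2 ler_piMl// ltW.
  have -> : b = (b + c * t) - c * t by ring.
  rewrite (le_trans (ler_normB _ _))// normrM (ger0_norm (ltW t0)).
  have := normr_ge0 c; nra.
split => //; apply: (@eq0_of_le_linear _ _ M) => t /[dup] /h + /andP[t0 t1].
rewrite a0 b0 mul0r !add0r normrM (ger0_norm (exprn_ge0 2 (ltW t0))).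
have -> : M * t ^+ 3 = M * t * t ^+ 2 by ring.
by rewrite ler_pM2r ?exprn_gt0.
Qed.

(** The product exceeds its truncation [low] of joint degree two by five nonnegative terms. As
    [y <= x <= 1], three of them are at most [x ^+ 3 * (l1 * r1)] each, one is at most twice that
    and one at most once, which gives the constant 6. *)
Lemma taylor2_mul_bounds (R : realFieldType) (e1 e2 l l1 e1' e2' r r1 x y : R) :
  0 < y -> y <= x -> x <= 1 -> 0 <= e1 -> 0 <= e2 -> 0 <= e1' -> 0 <= e2' ->
  0 <= l - (1 + e1 * x + e2 * x ^+ 2) <= x ^+ 3 * l1 ->
  0 <= r - (1 + e1' * y + e2' * y ^+ 2) <= y ^+ 3 * r1 ->
  1 + e1 + e2 <= l1 -> 1 + e1' + e2' <= r1 ->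
  let low := 1 + (x * e1 + (x ^+ 2 * e2 + (y * e1' + (y ^+ 2 * e2'
    + x * y * (e1 * e1'))))) in
  low <= l * r <= low + 6 * x ^+ 3 * (l1 * r1).
Proof.
move=> y0 yx x1 e10 e20 e10' e20'.
set p := l - _; have -> : l = p + (1 + e1 * x + e2 * x ^+ 2) by rewrite subrK.
set q := r - _; have -> : r = q + (1 + e1' * y + e2' * y ^+ 2) by rewrite subrK.
move=> /andP[p0 ple] /andP[q0 qle] hl hr /=.
have x0 : 0 < x by exact: lt_le_trans yx.
have y1 : y <= 1 by exact: le_trans x1.
have l10 : 0 < l1 by lra.
have r10 : 0 < r1 by lra.
have x3 : 0 < x ^+ 3 by rewrite exprn_gt0.
have y2y : y ^+ 2 <= y by rewrite expr2 ler_piMl// ltW.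
have x2x : x ^+ 2 <= x by rewrite expr2 ler_piMl// ltW.
have y20 : 0 < y ^+ 2 by rewrite exprn_gt0.
have x20 : 0 < x ^+ 2 by rewrite exprn_gt0.
have yx3 : y ^+ 3 <= x ^+ 3 by rewrite lerXn2r ?nnegrE ?(ltW x0) ?(ltW y0).
have q' : q <= x ^+ 3 * r1 by rewrite (le_trans qle)// ler_pM2r.
have y31 : y ^+ 3 <= 1 by rewrite exprn_ile1 ?(ltW y0).
have q1 : q <= r1 by rewrite (le_trans qle)// ger_pMl.
have m1 : x * y ^+ 2 <= x ^+ 3.
  by rewrite (exprS x 2) ler_pM2l// lerXn2r ?nnegrE ?(ltW x0) ?(ltW y0).
have m2 : x ^+ 2 * y <= x ^+ 3 by rewrite (exprSr x 2) ler_pM2l.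
have m3 : x ^+ 2 * y ^+ 2 <= x ^+ 3 by rewrite (le_trans _ m2)// ler_pM2l.
have k1 : e1 * e2' <= l1 * r1 by rewrite ler_pM//; lra.
have k2 : e2 * e1' <= l1 * r1 by rewrite ler_pM//; lra.
have k3 : e2 * e2' <= l1 * r1 by rewrite ler_pM//; lra.
have n1 : 0 <= (e1 * e2') * (x * y ^+ 2) <= l1 * r1 * x ^+ 3.
  by rewrite ler_pM ?andbT ?mulr_ge0// ltW.
have n2 : 0 <= (e2 * e1') * (x ^+ 2 * y) <= l1 * r1 * x ^+ 3.
  by rewrite ler_pM ?andbT ?mulr_ge0// ltW.
have n3 : 0 <= (e2 * e2') * (x ^+ 2 * y ^+ 2) <= l1 * r1 * x ^+ 3.
  by rewrite ler_pM ?andbT ?mulr_ge0// ltW.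
have e1y : e1' * y <= e1' by rewrite ler_piMr.
have e2y : e2' * y ^+ 2 <= e2' by rewrite ler_piMr// (le_trans y2y).
have e1x : e1 * x <= e1 by rewrite ler_piMr.
have e2x : e2 * x ^+ 2 <= e2 by rewrite ler_piMr// (le_trans x2x).
have e1y0 : 0 <= e1' * y by rewrite mulr_ge0// ltW.
have e2y0 : 0 <= e2' * y ^+ 2 by rewrite mulr_ge0// ltW.
have e1x0 : 0 <= e1 * x by rewrite mulr_ge0// ltW.
have e2x0 : 0 <= e2 * x ^+ 2 by rewrite mulr_ge0// ltW.
(* The factor 2 arises because [q] and the quadratic polynomial in [y] are each at most [r1]. *)
have n4 : 0 <= p * (q + (1 + e1' * y + e2' * y ^+ 2)) <= x ^+ 3 * l1 * (2 * r1).
  by rewrite mulr_ge0/= ?ler_pM//; lra.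
have n5 : 0 <= (1 + e1 * x + e2 * x ^+ 2) * q <= l1 * (x ^+ 3 * r1).
  by rewrite mulr_ge0/= ?ler_pM//; lra.
set low := (1 + (x * e1 + _)).
have -> : (p + (1 + e1 * x + e2 * x ^+ 2)) * (q + (1 + e1' * y + e2' * y ^+ 2)) =
  low + ((e1 * e2') * (x * y ^+ 2) + (e2 * e1') * (x ^+ 2 * y) +
  (e2 * e2') * (x ^+ 2 * y ^+ 2) + p * (q + (1 + e1' * y + e2' * y ^+ 2)) +
  (1 + e1 * x + e2 * x ^+ 2) * q) by rewrite /low; ring.
have -> : 6 * x ^+ 3 * (l1 * r1) = l1 * r1 * x ^+ 3 + l1 * r1 * x ^+ 3 +
  l1 * r1 * x ^+ 3 + x ^+ 3 * l1 * (2 * r1) + l1 * (x ^+ 3 * r1) by ring.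
by rewrite lerDl lerD2l; lra.
Qed.

(** Along the ray [y = k * x] the product becomes an expansion in one variable. With [S] bounding
    the quadratic polynomials on (0, 1], the two mixed terms give [2 * S * C], the product of the
    remainders gives [C ^+ 2], and the terms of degree 3 and 4 of the product of the polynomials
    give [3 * S ^+ 2]. *)
Lemma taylor2_mul_error (R : realFieldType) (a b C k x : R) (f : R -> R) :
  0 < k <= 1 -> 0 < x <= 1 ->
  (forall y, 0 < y <= 1 -> `|f y - (1 + a * y + b * y ^+ 2)| <= C * y ^+ 3) ->
  `|f x * f (k * x) -
    (1 + a * (1 + k) * x + (b * (1 + k ^+ 2) + k * a ^+ 2) * x ^+ 2)| <=
  (2 * (1 + `|a| + `|b|) * C + C ^+ 2 + 3 * (1 + `|a| + `|b|) ^+ 2) * x ^+ 3.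
Proof.
move=> /andP[k0 k1] /andP[x0 x1] hf; set S := 1 + `|a| + `|b|.
have a0 := normr_ge0 a; have b0 := normr_ge0 b.
have S1 : 1 <= S by rewrite /S; lra.
have S0 : 0 <= S by exact: le_trans S1.
have C0 : 0 <= C.
  have := hf 1; rewrite ltr01 lexx !expr1n !mulr1 => /(_ isT).
  exact: le_trans (normr_ge0 _).
have x3 : 0 < x ^+ 3 by rewrite exprn_gt0.
have x31 : x ^+ 3 <= 1 by rewrite exprn_ile1 ?(ltW x0).
have kx0 : 0 < k * x by rewrite mulr_gt0.
have kxx : k * x <= x by rewrite ger_pMl.
have kx1 : k * x <= 1 by exact: le_trans x1.
have pS y : 0 < y -> y <= 1 -> `|1 + a * y + b * y ^+ 2| <= S.
  move=> y0 y1; rewrite (le_trans (ler_normD _ _))// /S lerD//.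
    rewrite (le_trans (ler_normD _ _))// normr1 lerD2l normrM ler_piMr//.
    by rewrite gtr0_norm.
  by rewrite normrM ler_piMr// ger0_norm ?exprn_ge0 ?exprn_ile1 ?(ltW y0).
have h1 : `|f x - (1 + a * x + b * x ^+ 2)| <= C * x ^+ 3.
  by apply: hf; rewrite x0.
have h2 : `|f (k * x) - (1 + a * (k * x) + b * (k * x) ^+ 2)| <= C * x ^+ 3.
  rewrite (le_trans (hf _ _)) ?kx0// ler_wpM2l//.
  by rewrite lerXn2r ?nnegrE ?(ltW x0) ?(ltW kx0).
have p1 := pS _ x0 x1; have p2 := pS _ kx0 kx1.
move: h1 h2; set r := f x - _; set r' := f (k * x) - _ => h1 h2.
have -> : f x = r + (1 + a * x + b * x ^+ 2) by rewrite /r subrK.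
have -> : f (k * x) = r' + (1 + a * (k * x) + b * (k * x) ^+ 2) by rewrite /r' subrK.
have -> : (r + (1 + a * x + b * x ^+ 2)) *
    (r' + (1 + a * (k * x) + b * (k * x) ^+ 2)) -
    (1 + a * (1 + k) * x + (b * (1 + k ^+ 2) + k * a ^+ 2) * x ^+ 2) =
  r * (1 + a * (k * x) + b * (k * x) ^+ 2) + r' * (1 + a * x + b * x ^+ 2) +
  r * r' + (a * b * (k ^+ 2 + k) + b * b * (k ^+ 2 * x)) * x ^+ 3 by ring.
have -> : (2 * S * C + C ^+ 2 + 3 * S ^+ 2) * x ^+ 3 =
  C * x ^+ 3 * S + C * x ^+ 3 * S + C * x ^+ 3 * C + (S * S * 2 + S * S * 1) * x ^+ 3.
  by ring.
have aS : `|a| <= S by rewrite /S; lra.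
have bS : `|b| <= S by rewrite /S; lra.
have k20 : 0 <= k ^+ 2 by rewrite exprn_ge0// ltW.
have k21 : k ^+ 2 <= 1 by rewrite exprn_ile1 ?(ltW k0).
rewrite (le_trans (ler_normD _ _))// lerD//; last first.
  rewrite normrM (gtr0_norm x3) ler_wpM2r// ?(ltW x3)//.
  rewrite (le_trans (ler_normD _ _))// lerD// normrM ler_pM//.
  - by rewrite normrM ler_pM.
  - by rewrite ger0_norm; lra.
  - by rewrite normrM ler_pM.
  - by rewrite ger0_norm ?mulr_ge0 ?mulr_ile1// ltW.
rewrite (le_trans (ler_normD _ _))// lerD//; last first.
  rewrite normrM ler_pM// (le_trans h2)// ler_piMr//.
by rewrite (le_trans (ler_normD _ _))// lerD// normrM ler_pM.
Qed.

(** * Moments of symmetric functions of random sequences *)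

Section random_sequences.
Local Open Scope ereal_scope.
Variables (R : realType) (d : measure_display) (T : measurableType d).
Variable P : probability T R.

Lemma measurable_eprod1D (s : nat -> T -> R) (x : R) : (0 <= x)%R ->
  (forall n w, (0 <= s n w)%R) -> (forall n, measurable_fun setT (s n)) ->
  measurable_fun setT (fun w => eprod1D (s ^~ w) x).
Proof.
move=> x0 s0 ms.
apply: (@emeasurable_fun_cvg _ _ _ _
  (fun N w => (\prod_(0 <= n < N) (1 + x * s n w))%:E)).
  move=> N; apply/measurable_EFinP; apply: measurable_prod => i _.
  apply: measurable_funD; first exact: measurable_cst.
  by apply: measurable_funM => //; exact: measurable_cst.
by move=> w _; apply: is_cvg_eprod1D.
Qed.

Lemma measurable_esym1 (s : nat -> T -> R) :
  (forall n w, (0 <= s n w)%R) -> (forall n, measurable_fun setT (s n)) ->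
  measurable_fun setT (fun w => esym1 (s ^~ w)).
Proof.
move=> s0 ms; rewrite /esym1.
apply: (@emeasurable_fun_cvg _ _ _ _
  (fun N w => \sum_(0 <= n < N) (s n w)%:E)).
  by move=> N; apply: emeasurable_sum => n; apply/measurable_EFinP.
by move=> w _; apply: is_cvg_nneseries => n _ _; rewrite lee_fin.
Qed.

Lemma measurable_esym2 (s : nat -> T -> R) :
  (forall n w, (0 <= s n w)%R) -> (forall n, measurable_fun setT (s n)) ->
  measurable_fun setT (fun w => esym2 (s ^~ w)).
Proof.
move=> s0 ms; rewrite /esym2.
apply: (@measurable_esym1 (fun n w => s n w * \sum_(0 <= m < n) s m w)%R).
  by move=> n w; rewrite mulr_ge0// sumr_ge0.
by move=> n; apply: measurable_funM => //; exact: measurable_sum.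
Qed.

Lemma esym1_ge0 (s : nat -> R) : (forall n, (0 <= s n)%R) -> 0 <= esym1 s.
Proof. by move=> s0; apply: nneseries_ge0 => n _ _; rewrite lee_fin. Qed.

Lemma esym2_ge0 (s : nat -> R) : (forall n, (0 <= s n)%R) -> 0 <= esym2 s.
Proof.
move=> s0; apply: nneseries_ge0 => n _ _.
by rewrite lee_fin mulr_ge0// sumr_ge0.
Qed.

Variables s t : nat -> T -> R.
Hypotheses (s0 : forall n w, (0 <= s n w)%R) (t0 : forall n w, (0 <= t n w)%R).
Hypotheses (ms : forall n, measurable_fun setT (s n))
  (mt : forall n, measurable_fun setT (t n)).

Let L x w := eprod1D (s ^~ w) x.
Let M y w := eprod1D (t ^~ w) y.
Let G x y := \int[P]_w (L x w * M y w).

Hypothesis G11 : G 1%R 1%R < +oo.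

(** The truncation of [L x w * M y w] at joint degree two, kept in the extended reals because its
    coefficients are known to be finite only almost everywhere. *)
Let low x y w := 1 + (x%:E * esym1 (s ^~ w) + ((x ^+ 2)%:E * esym2 (s ^~ w)
  + (y%:E * esym1 (t ^~ w) + ((y ^+ 2)%:E * esym2 (t ^~ w)
  + (x * y)%:E * (esym1 (s ^~ w) * esym1 (t ^~ w)))))).

Let L_ge1 x w : (0 <= x)%R -> 1 <= L x w.
Proof. by move=> x0; apply: eprod1D_ge1. Qed.

Let M_ge1 x w : (0 <= x)%R -> 1 <= M x w.
Proof. by move=> x0; apply: eprod1D_ge1. Qed.

Let LM_ge0 x y w : (0 <= x)%R -> (0 <= y)%R -> 0 <= L x w * M y w.
Proof.
move=> x0 y0.
by rewrite mule_ge0// (le_trans _ (L_ge1 w x0), le_trans _ (M_ge1 w y0)).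
Qed.

Let mLM x y : (0 <= x)%R -> (0 <= y)%R ->
  measurable_fun setT (fun w => L x w * M y w).
Proof. by move=> x0 y0; apply: emeasurable_funM; apply: measurable_eprod1D. Qed.

Let ae_finite : {ae P, forall w, L 1%R w < +oo /\ M 1%R w < +oo}.
Proof.
have LM1 w : 0 <= L 1%R w * M 1%R w by exact: LM_ge0.
have : P.-integrable setT (fun w => L 1%R w * M 1%R w).
  apply/integrableP; split; first exact: mLM.
  by under eq_integral do rewrite gee0_abs//.
move/integrable_ae => /(_ measurableT); apply: filterS => w /= /(_ I).
move: (L_ge1 w ler01) (M_ge1 w ler01).
(* Since both factors are at least 1, an infinite factor would make the product infinite. *)
case: (L 1%R w) => [a| |]//; case: (M 1%R w) => [b| |]//.
- by split; exact: ltry.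
- by move=> a1 _; rewrite gt0_muley// (lt_le_trans _ a1)// lte01.
- by move=> _ a1; rewrite gt0_mulye// (lt_le_trans _ a1)// lte01.
Qed.

Let ae_bounds x y : (0 < y)%R -> (y <= x)%R -> (x <= 1)%R ->
  {ae P, forall w, low x y w <= L x w * M y w /\
    L x w * M y w <= low x y w + (6 * x ^+ 3)%:E * (L 1%R w * M 1%R w)}.
Proof.
move=> y0 yx x1; apply: filterS ae_finite => w [Lfin Mfin].
have [e1 [e2 [l [Es1 Es2 e10 e20 hl]]]] := eprod1D_taylor2 (s0 ^~ w) Lfin.
have [e1' [e2' [r [Et1 Et2 e10' e20' hr]]]] := eprod1D_taylor2 (t0 ^~ w) Mfin.
have x01 : (0 <= x <= 1)%R by rewrite x1 (le_trans (ltW y0)).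
have y01 : (0 <= y <= 1)%R by rewrite (le_trans yx)// ltW.
have u01 : (0 <= (1 : R) <= 1)%R by rewrite ler01 lexx.
have [l1 /andP[hl1 _]] := hl _ u01; have [r1 /andP[hr1 _]] := hr _ u01.
have [lx hlx] := hl _ x01; have [ry hry] := hr _ y01.
have := @taylor2_mul_bounds _ e1 e2 (l x) (l 1%R) e1' e2' (r y) (r 1%R) x y
  y0 yx x1 e10 e20 e10' e20' hlx hry.
rewrite expr1n !mulr1 in hl1 hr1.
rewrite -subr_ge0 in hl1.
move=> /(_ ltac:(lra) ltac:(lra)) /andP[b1 b2].
rewrite /low /L /M Es1 Es2 Et1 Et2 lx ry l1 r1 -!EFinM -!EFinD !lee_fin.
by split.
Qed.

Let E1 := \int[P]_w esym1 (s ^~ w).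
Let E2 := \int[P]_w esym2 (s ^~ w).
Let F1 := \int[P]_w esym1 (t ^~ w).
Let F2 := \int[P]_w esym2 (t ^~ w).
Let EF := \int[P]_w (esym1 (s ^~ w) * esym1 (t ^~ w)).

(** All terms are nonnegative, so the integral is additive before any of the moments is known to be
    finite. *)
Let int_low x y : (0 <= x)%R -> (0 <= y)%R -> \int[P]_w low x y w =
  1 + (x%:E * E1 + ((x ^+ 2)%:E * E2 + (y%:E * F1 + ((y ^+ 2)%:E * F2
  + (x * y)%:E * EF)))).
Proof.
move=> x0 y0; rewrite /low.
have x20 : (0 <= x ^+ 2)%R by rewrite exprn_ge0.
have y20 : (0 <= y ^+ 2)%R by rewrite exprn_ge0.
have xy0 : (0 <= x * y)%R by rewrite mulr_ge0.
rewrite /E1 /E2 /F1 /F2 /EF.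
have [] : [/\ measurable_fun setT (fun w => esym1 (s ^~ w)),
  measurable_fun setT (fun w => esym1 (t ^~ w)),
  measurable_fun setT (fun w => esym2 (s ^~ w)) &
  measurable_fun setT (fun w => esym2 (t ^~ w))].
  by split; [exact: measurable_esym1|exact: measurable_esym1|
    exact: measurable_esym2|exact: measurable_esym2].
have [] : [/\ forall w, 0 <= esym1 (s ^~ w), forall w, 0 <= esym1 (t ^~ w),
  forall w, 0 <= esym2 (s ^~ w) & forall w, 0 <= esym2 (t ^~ w)].
  by split=> w; [exact: esym1_ge0|exact: esym1_ge0|
    exact: esym2_ge0|exact: esym2_ge0].
(* The four random variables become opaque names, so that only their sign and measurability matter
   in what follows. *)
move Da : (fun w => esym1 (s ^~ w)) => a; move Db : (fun w => esym1 (t ^~ w)) => b.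
move Da2 : (fun w => esym2 (s ^~ w)) => a2; move Db2 : (fun w => esym2 (t ^~ w)) => b2.
have aE w : esym1 (s ^~ w) = a w by rewrite -Da.
have bE w : esym1 (t ^~ w) = b w by rewrite -Db.
have a2E w : esym2 (s ^~ w) = a2 w by rewrite -Da2.
have b2E w : esym2 (t ^~ w) = b2 w by rewrite -Db2.
under eq_integral do rewrite aE bE a2E b2E.
under [X in _ = _ + (_ + (_ + (_ + (_ + _ * X))))]eq_integral do rewrite aE bE.
move=> a0 b0 a20 b20 ma mb ma2 mb2.
have {}a0 w : 0 <= a w by rewrite -aE.
have {}b0 w : 0 <= b w by rewrite -bE.
have {}a20 w : 0 <= a2 w by rewrite -a2E.
have {}b20 w : 0 <= b2 w by rewrite -b2E.
have mZ (k : R) (f : T -> \bar R) : measurable_fun setT f ->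
    measurable_fun setT (fun w => k%:E * f w).
  by move=> mf; apply: emeasurable_funM => //; exact: measurable_cst.
have mab : measurable_fun setT (fun w => a w * b w) by exact: emeasurable_funM.
have ab0 w : 0 <= a w * b w by rewrite mule_ge0.
rewrite ge0_integralD//; last 2 first.
- by move=> w _; rewrite !adde_ge0// mule_ge0// ?lee_fin.
- by do 4! [apply: emeasurable_funD; first exact: mZ]; exact: mZ.
rewrite integral_cst//= probability_setT mule1; congr (_ + _).
rewrite ge0_integralD//; last 4 first.
- by move=> w _; rewrite mule_ge0// ?lee_fin.
- exact: mZ.
- by move=> w _; rewrite !adde_ge0// mule_ge0// ?lee_fin.
- by do 3! [apply: emeasurable_funD; first exact: mZ]; exact: mZ.
rewrite ge0_integralZl_EFin//; congr (_ + _).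
rewrite ge0_integralD//; last 4 first.
- by move=> w _; rewrite mule_ge0// ?lee_fin.
- exact: mZ.
- by move=> w _; rewrite !adde_ge0// mule_ge0// ?lee_fin.
- by do 2! [apply: emeasurable_funD; first exact: mZ]; exact: mZ.
rewrite ge0_integralZl_EFin//; congr (_ + _).
rewrite ge0_integralD//; last 4 first.
- by move=> w _; rewrite mule_ge0// ?lee_fin.
- exact: mZ.
- by move=> w _; rewrite !adde_ge0// mule_ge0// ?lee_fin.
- by apply: emeasurable_funD; exact: mZ.
rewrite ge0_integralZl_EFin//; congr (_ + _).
rewrite ge0_integralD//; last 4 first.
- by move=> w _; rewrite mule_ge0// ?lee_fin.
- exact: mZ.
- by move=> w _; rewrite mule_ge0// ?lee_fin.
- exact: mZ.
by rewrite !ge0_integralZl_EFin.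
Qed.

(** Integrating the pointwise bounds encloses [G x y] between the truncation with averaged
    coefficients and the same plus a cubic error. On a ray this is compared with the expansion of
    [K * (f x * f y)]. The constant term gives [K = 1]; the terms of degree one and two give linear
    equations for the moments. *)
Theorem esym_moments (f : R -> R) (K f1 f2 C : R) :
  (forall x, 0 < x <= 1 -> `|f x - (1 + f1 * x + f2 * x ^+ 2)| <= C * x ^+ 3)%R ->
  (forall x y, (0 < x <= 1)%R -> (0 < y <= 1)%R -> G x y = (K * (f x * f y))%:E) ->
  [/\ E1 = f1%:E, F1 = f1%:E, E2 = f2%:E, F2 = f2%:E & EF = (f1 ^+ 2)%:E].
Proof.
move=> hf hG.
have low0 x y w : (0 <= x)%R -> (0 <= y)%R -> 0 <= low x y w.
  move=> x0 y0; rewrite /low.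
  have := esym1_ge0 (s0 ^~ w); have := esym1_ge0 (t0 ^~ w).
  have := esym2_ge0 (s0 ^~ w); have := esym2_ge0 (t0 ^~ w).
  move: (esym1 _) (esym1 _) (esym2 _) (esym2 _) => a b a2 b2 b20 a20 b0 a0.
  by rewrite !adde_ge0// !mule_ge0// lee_fin ?exprn_ge0 ?mulr_ge0.
have mlow x y : measurable_fun setT (low x y).
  have mZ (k : R) (g : T -> \bar R) : measurable_fun setT g ->
      measurable_fun setT (fun w => k%:E * g w).
    by move=> mg; apply: emeasurable_funM => //; exact: measurable_cst.
  rewrite /low; apply: emeasurable_funD; first exact: measurable_cst.
  apply: emeasurable_funD; first by apply: mZ; exact: measurable_esym1.
  apply: emeasurable_funD; first by apply: mZ; exact: measurable_esym2.
  apply: emeasurable_funD; first by apply: mZ; exact: measurable_esym1.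
  apply: emeasurable_funD; first by apply: mZ; exact: measurable_esym2.
  by apply: mZ; apply: emeasurable_funM; exact: measurable_esym1.
have bnd x y : (0 < y)%R -> (y <= x)%R -> (x <= 1)%R ->
    \int[P]_w low x y w <= G x y /\
    G x y <= \int[P]_w low x y w + (6 * x ^+ 3)%:E * G 1 1.
  move=> y0 yx x1; have x0 : (0 < x)%R by exact: lt_le_trans yx.
  have aeb := ae_bounds y0 yx x1.
  have x3 : (0 <= 6 * x ^+ 3)%R by rewrite mulr_ge0// exprn_ge0// ltW.
  split.
    apply: ae_ge0_le_integral => //.
    - by move=> w _; rewrite low0// ltW.
    - by move=> w _; rewrite LM_ge0// ltW.
    - by apply: mLM; exact: ltW.
    - by apply: filterS aeb => w [].
  rewrite /G -ge0_integralZl_EFin//; last 2 first.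
  - by move=> w _; rewrite LM_ge0.
  - exact: mLM.
  have mLM6 : measurable_fun setT (fun w => (6 * x ^+ 3)%:E * (L 1%R w * M 1%R w)).
    by apply: emeasurable_funM; [exact: measurable_cst|exact: mLM].
  have LM60 w : 0 <= (6 * x ^+ 3)%:E * (L 1%R w * M 1%R w).
    by rewrite mule_ge0// ?LM_ge0.
  rewrite -ge0_integralD//; last by move=> w _; rewrite low0// ltW.
  apply: ae_ge0_le_integral => //.
  - by move=> w _; rewrite LM_ge0// ltW.
  - by apply: mLM; exact: ltW.
  - by move=> w _; rewrite adde_ge0// low0// ltW.
  - exact: emeasurable_funD.
  - by apply: filterS aeb => w [].
have E1_0 : 0 <= E1 by apply: integral_ge0 => w _; exact: esym1_ge0.
have E2_0 : 0 <= E2 by apply: integral_ge0 => w _; exact: esym2_ge0.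
have F1_0 : 0 <= F1 by apply: integral_ge0 => w _; exact: esym1_ge0.
have F2_0 : 0 <= F2 by apply: integral_ge0 => w _; exact: esym2_ge0.
have EF_0 : 0 <= EF.
  by apply: integral_ge0 => w _; rewrite mule_ge0// esym1_ge0.
(* The integral of [low 1 1] is at most [G 1 1]. Its terms are nonnegative, so the case analysis
   below can discard every infinite moment. *)
have : \int[P]_w low 1 1 w < +oo.
  by have [h _] := bnd 1%R 1%R ltr01 (lexx _) (lexx _); exact: le_lt_trans G11.
move: E1_0 E2_0 F1_0 F2_0 EF_0 (fun x y x0 y0 => @int_low x y x0 y0).
case: E1 => [a1| |]//; case: E2 => [a2| |]//; case: F1 => [b1| |]//;
  case: F2 => [b2| |]//; case: EF => [m| |]//; move=> _ _ _ _ _ il;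
  rewrite il// expr1n mulr1 ?mul1e//= => _.
have G0 : 0 <= G 1 1 by apply: integral_ge0 => w _; rewrite LM_ge0.
have [g g0 gE] : exists2 g : R, (0 <= g)%R & G 1 1 = g%:E.
  by move: G0 G11; case: (G 1 1) => [g| |]// g0 _; exists g.
pose S := (2 * (1 + `|f1| + `|f2|) * C + C ^+ 2 + 3 * (1 + `|f1| + `|f2|) ^+ 2)%R.
have key k : (0 < k <= 1)%R ->
  [/\ 1 - K = 0, a1 + k * b1 - K * (f1 * (1 + k)) = 0 &
    a2 + k ^+ 2 * b2 + k * m - K * (f2 * (1 + k ^+ 2) + k * f1 ^+ 2) = 0]%R.
  move=> /andP[k0 k1].
  apply: (@quadratic_eq0_of_le_cubic _ _ _ _ (6 * g + `|K| * S)%R) => x /andP[x0 x1].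
  have kx0 : (0 < k * x)%R by rewrite mulr_gt0.
  have kxx : (k * x <= x)%R by rewrite ger_pMl.
  have [] := bnd x (k * x)%R kx0 kxx x1.
  have kx1 : (k * x <= 1)%R by exact: le_trans x1.
  rewrite (il _ _ (ltW x0) (ltW kx0)) gE hG ?x0 ?kx0//.
  rewrite -!EFinM -!EFinD !lee_fin => lo up.
  have := taylor2_mul_error (k := k) (x := x) _ _ hf.
  rewrite k0 k1 x0 x1 -/S => /(_ isT isT) tay.
  set q := (1 + f1 * (1 + k) * x + _)%R in tay.
  (* The quadratic is split into the averaged truncation minus the exact value of [G], bounded by
     [6 * g * x ^+ 3], and [K] times the expansion error of [f x * f (k * x)], bounded by
     [|K| * S * x ^+ 3]. *)
  have -> : (1 - K + (a1 + k * b1 - K * (f1 * (1 + k))) * x +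
     (a2 + k ^+ 2 * b2 + k * m - K * (f2 * (1 + k ^+ 2) + k * f1 ^+ 2)) * x ^+ 2 =
    (1 + (x * a1 + (x ^+ 2 * a2 + (k * x * b1 + ((k * x) ^+ 2 * b2 +
      x * (k * x) * m)))) - K * (f x * f (k * x))) + K * (f x * f (k * x) - q))%R.
    by rewrite /q; ring.
  rewrite (le_trans (ler_normD _ _))// mulrDl lerD//; last first.
    by rewrite normrM -mulrA ler_wpM2l.
  rewrite ler_norml; apply/andP; split; lra.
(* Three rays suffice: the coefficients of [t^2] are quadratic in the slope. *)
have [K1 h1 h1'] := key 1%R ltac:(by rewrite ltr01 lexx).
have K1' : K = 1%R by lra.
have [_ h2 h2'] := key 2^-1%R ltac:(by apply/andP; split; lra).
have [_ _ h3'] := key 4^-1%R ltac:(by apply/andP; split; lra).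
rewrite {}K1' in h1 h1' h2 h2' h3'.
by split; congr EFin; move: h1 h1' h2 h2' h3'; lra.
Qed.

End random_sequences.

(** * Singular values as nonnegative sequences *)

(** Indices outside [D] carry the value 0, hence contribute a factor 1 to products and nothing to
    sums. Finite and infinite families thus become one kind of sequence. *)
Definition inv_sqr (R : realType) (D : set nat) (xi : nat -> R) (n : nat) : R :=
  if n \in D then (xi n ^+ 2)^-1 else 0.

Section levels.
Variables (R : realType) (D : set nat) (xi : nat -> R).

Lemma inv_sqr_ge0 n : 0 <= inv_sqr D xi n.
Proof. by rewrite /inv_sqr; case: ifP => // _; rewrite invr_ge0 sqr_ge0. Qed.

Lemma detprodE j : detprod D xi j = eprod1D (inv_sqr D xi) (j ^+ 2).
Proof.
rewrite /detprod /eprod1D; congr (limn _); apply/funext => N; congr EFin.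
rewrite big_mkcond/=; apply: eq_bigr => n _.
by rewrite /inv_sqr; case: ifP => // _; rewrite mulr0 addr0.
Qed.

Lemma sum_inv2E : sum_inv2 D xi = esym1 (inv_sqr D xi).
Proof.
rewrite /sum_inv2 /esym1 nneseries_esumT; last first.
  by move=> n; rewrite lee_fin inv_sqr_ge0.
rewrite esum_mkcond; apply: eq_esum => n _.
by rewrite /inv_sqr; case: ifP.
Qed.

(** As [inv_sqr] vanishes outside [D], the sum may run over all pairs [m < n]. Grouping them by the
    larger index gives a double sum with finite inner range, which is allowed for nonnegative
    terms. *)
Lemma sum_inv4E : sum_inv4 D xi = esym2 (inv_sqr D xi).
Proof.
pose s := inv_sqr D xi; have s0 := inv_sqr_ge0 : forall n, 0 <= s n.
transitivity (\esum_(p in [set p : nat * nat | (p.1 < p.2)%N])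
    (s p.2 * s p.1)%:E)%E.
  rewrite /sum_inv4 esum_mkcond [RHS]esum_mkcond; apply: eq_esum => p _.
  rewrite /s /inv_sqr invfM [in RHS]mulrC.
  have -> : p \in [set q : nat * nat | [/\ D q.1, D q.2 & (q.1 < q.2)%N]] =
    [&& p.1 \in D, p.2 \in D & p \in [set q : nat * nat | (q.1 < q.2)%N]].
    apply/idP/idP => [/set_mem[/mem_set -> /mem_set -> ?]|]; first exact: mem_set.
    by move=> /and3P[/set_mem ? /set_mem ? /set_mem ?]; exact: mem_set.
  case: (p.1 \in D); case: (p.2 \in D); rewrite ?mulr0 ?mul0r//=; by case: ifP.
pose J n := [set m | (m < n)%N].
(* Swapping the components puts the larger index first, so that the pairs form the fibred set over
   [J]. *)
rewrite (@reindex_esum _ _ _ ([set: nat] `*`` J) _ (fun p => (p.2, p.1))); last first.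
  split.
  - by move=> p [_ /= pJ].
  - by move=> [p q] [p' q'] _ _ [-> ->].
  - by move=> [p q] /= pq; exists (q, p).
rewrite -(@esum_esum R nat nat [set: nat] J (fun n m => (s n * s m)%:E)); last first.
  by move=> n m _ _; rewrite lee_fin mulr_ge0.
rewrite /esym2 nneseries_esumT; last first.
  by move=> n; rewrite lee_fin mulr_ge0// sumr_ge0.
apply: eq_esum => n _; rewrite esum_fset//; last first.
- by move=> m _; rewrite lee_fin mulr_ge0.
- exact: finite_II.
by rewrite /J -fsbig_ord big_mkord mulr_sumr sumEFin.
Qed.

End levels.

Lemma measurable_inv_sqr (R : realType) (d : measure_display)
    (T : measurableType d) (D : set nat) (xi : nat -> T -> R) n :
  measurable_fun setT (xi n) ->
  measurable_fun setT (fun w => inv_sqr D (xi ^~ w) n).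
Proof.
move=> mxi; rewrite /inv_sqr; case: (n \in D) => //.
(* Written as a real power, the inverse is a measurable function on the whole line, including at
   0. *)
have -> : (fun w => (xi n w ^+ 2)^-1) = (fun w => (xi n w ^+ 2) `^ (- 1)).
  by apply/funext => w; rewrite powR_inv1// sqr_ge0.
apply: (measurableT_comp (measurable_powR _)) => //.
exact: measurable_funX.
Qed.

(** * Modified Bessel functions *)

(** For [x] in [0, 1] and nonnegative coefficients, each term of degree at least 3 is at most its
    coefficient times [x ^+ 3]; the sum of all coefficients bounds the tail. *)
Lemma power_series_taylor2 (R : realType) (a : nat -> R) (x : R) :
  (forall k, 0 <= a k) -> cvgn (series a) -> 0 <= x <= 1 ->
  `|limn (series (fun k => a k * x ^+ k)) - (a 0%N + a 1%N * x + a 2 * x ^+ 2)|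
  <= limn (series a) * x ^+ 3.
Proof.
move=> a0 ca /andP[x0 x1].
have ax0 k : 0 <= a k * x ^+ k by rewrite mulr_ge0// exprn_ge0.
have cax : cvgn (series (fun k => a k * x ^+ k)).
  apply: series_le_cvg ca => // k.
  by rewrite ler_piMr// exprn_ile1.
have split3 n : series (fun k => a k * x ^+ k) (n + 3)%N =
    a 0%N + a 1%N * x + a 2 * x ^+ 2 + \sum_(0 <= k < n) a k.+3 * x ^+ k.+3.
  rewrite /series/= addn3 !big_nat_recl//= expr0 mulr1 expr1 !addrA.
  by congr (_ + _); apply: eq_bigr.
have tail_le n : \sum_(0 <= k < n) a k.+3 * x ^+ k.+3 <= limn (series a) * x ^+ 3.
  apply: (@le_trans _ _ (series a (n + 3)%N * x ^+ 3)); last first.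
    rewrite ler_wpM2r ?exprn_ge0//; apply: nondecreasing_cvgn_le => //.
    by apply/nondecreasing_seqP => k; rewrite seriesSr lerDl.
  rewrite /series/= addn3 !big_nat_recl//= !addrA.
  apply: (@le_trans _ _ ((\sum_(0 <= k < n) a k.+3) * x ^+ 3)).
    rewrite mulr_suml; apply: ler_sum => k _; rewrite ler_wpM2l//.
    by rewrite -addn3 exprD ler_piMl ?exprn_ge0// exprn_ile1.
  by rewrite ler_wpM2r ?exprn_ge0// lerDr !addr_ge0.
have cs : (fun n => series (fun k => a k * x ^+ k) (n + 3)%N) @ \oo -->
    limn (series (fun k => a k * x ^+ k)).
  by rewrite (cvg_shiftn 3 (series (fun k => a k * x ^+ k))).
rewrite ger0_norm.
  rewrite lerBlDl; apply: (cvgr_to_le cs); near=> n.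
  by rewrite split3 lerD2l.
rewrite subr_ge0; apply: (cvgr_to_ge cs); near=> n.
by rewrite split3 lerDl sumr_ge0.
Unshelve. all: by end_near.
Qed.

Definition besselI_red_coeff (R : realType) (nu : nat) (y : R) (k : nat) : R :=
  nu`!%:R / (k`! * (k + nu)`!)%:R * y ^+ k.

Definition besselI_red (R : realType) (nu : nat) (y : R) : R :=
  limn (series (besselI_red_coeff nu y)).

Section bessel.
Variables (R : realType) (nu : nat).

Let factr_neq0 n : n`!%:R != 0 :> R.
Proof. by rewrite pnatr_eq0 -lt0n fact_gt0. Qed.

Lemma besselI_red_coeff_ge0 (y : R) k : 0 <= y -> 0 <= besselI_red_coeff nu y k.
Proof.
by move=> y0; rewrite /besselI_red_coeff mulr_ge0 ?exprn_ge0// divr_ge0.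
Qed.

Lemma is_cvg_besselI_red (y : R) : 0 <= y ->
  cvgn (series (besselI_red_coeff nu y)).
Proof.
move=> y0; apply: series_le_cvg (is_cvg_series_exp_coeff y) => k.
- exact: besselI_red_coeff_ge0.
- by rewrite /exp_coeff/= divr_ge0// exprn_ge0.
rewrite /exp_coeff/= /besselI_red_coeff mulrC ler_wpM2l ?exprn_ge0//.
rewrite natrM invfM mulrCA ler_piMr ?invr_ge0//.
rewrite ler_pdivrMr ?ltr0n ?fact_gt0// mul1r ler_nat.
by rewrite leq_fact// leq_addl.
Qed.

Lemma besselI_coeff_red (z : R) k :
  besselI_coeff nu z k = (z / 2) ^+ nu / nu`!%:R * besselI_red_coeff nu ((z / 2) ^+ 2) k.
Proof.
rewrite /besselI_coeff /besselI_red_coeff exprD exprM !natrM.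
by field; rewrite !factr_neq0.
Qed.

Lemma besselI_redE (z : R) :
  besselI nu z = (z / 2) ^+ nu / nu`!%:R * besselI_red nu ((z / 2) ^+ 2).
Proof.
rewrite /besselI /besselI_red.
have -> : series (besselI_coeff nu z) = (fun n => (z / 2) ^+ nu / nu`!%:R *
    series (besselI_red_coeff nu ((z / 2) ^+ 2)) n).
  apply/funext => n; rewrite /series/= mulr_sumr.
  by apply: eq_bigr => k _; exact: besselI_coeff_red.
by apply/cvg_lim => //; apply: cvgMr; apply: is_cvg_besselI_red; exact: sqr_ge0.
Qed.

Lemma is_cvg_besselI (z : R) : cvgn (series (besselI_coeff nu z)).
Proof.
have -> : series (besselI_coeff nu z) = (fun n => (z / 2) ^+ nu / nu`!%:R *
    series (besselI_red_coeff nu ((z / 2) ^+ 2)) n).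
  apply/funext => n; rewrite /series/= mulr_sumr.
  by apply: eq_bigr => k _; exact: besselI_coeff_red.
apply: is_cvgMr; apply: is_cvg_besselI_red; exact: sqr_ge0.
Qed.

(** The scale [y] is absorbed into the coefficients, leaving a power series in [x]. For
    [y = (V4 * Phi) ^+ 2] the coefficients of degree one and two are the values in the sum rules. *)
Lemma besselI_red_taylor2 (y x : R) : 0 <= y -> 0 < x <= 1 ->
  `|besselI_red nu (y * x) - (1 + y / nu.+1%:R * x +
     y ^+ 2 / (2 * nu.+1%:R * nu.+2%:R) * x ^+ 2)| <= besselI_red nu y * x ^+ 3.
Proof.
move=> y0 /andP[x0 x1].
have := @power_series_taylor2 R (besselI_red_coeff nu y) x
  (fun k => besselI_red_coeff_ge0 k y0) (is_cvg_besselI_red y0).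
rewrite x1 ltW// => /(_ isT).
rewrite /besselI_red; congr (`|limn (series _) - _| <= _).
  by apply/funext => k; rewrite /besselI_red_coeff exprMn mulrA.
rewrite /besselI_red_coeff expr0 expr1 !add0n !mulr1 add1n add2n !factS fact0 !mul1n.
rewrite !natrM; congr (_ + _ * _ + _ * _).
- by rewrite divff.
- by field; rewrite factr_neq0 nat1r pnatr_eq0.
- by field; rewrite factr_neq0 nat1r -(natrD R 2 nu) !pnatr_eq0.
Qed.

End bessel.

(** * Averages over the circle *)

Section complex_parts.
Variable R : realType.
Implicit Types z w : R[i].

Lemma ReMc z w : complex.Re (z * w) =
  complex.Re z * complex.Re w - complex.Im z * complex.Im w.
Proof. by case: z; case: w. Qed.

Lemma ImMc z w : complex.Im (z * w) =
  complex.Re z * complex.Im w + complex.Im z * complex.Re w.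
Proof. by case: z; case: w. Qed.

Lemma Re_sum (I : Type) (r : seq I) (Q : pred I) (F : I -> R[i]) :
  complex.Re (\sum_(i <- r | Q i) F i) = \sum_(i <- r | Q i) complex.Re (F i).
Proof. by apply: big_morph => // -[? ?] [? ?]. Qed.

Lemma Re_conjc z : complex.Re z^*%C = complex.Re z.
Proof. by case: z. Qed.

Lemma Re_real_mul (x : R) z : complex.Re (x%:C * z) = x * complex.Re z.
Proof. by case: z => a b; rewrite ReMc /= mul0r subr0. Qed.

(** The squared modulus as an element of [R]; the norm on [R[i]] takes its values in [R[i]]. *)
Definition sqrnormc z : R := complex.Re z ^+ 2 + complex.Im z ^+ 2.

Lemma sqrnormcM z w : sqrnormc (z * w) = sqrnormc z * sqrnormc w.
Proof. by rewrite /sqrnormc ReMc ImMc; ring. Qed.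

Lemma sqrnormc1 : sqrnormc 1 = 1.
Proof. by rewrite /sqrnormc/= expr1n expr0n addr0. Qed.

Lemma sqrnormcX z n : sqrnormc (z ^+ n) = sqrnormc z ^+ n.
Proof.
elim: n => [|n IH]; first by rewrite !expr0 sqrnormc1.
by rewrite !exprS sqrnormcM IH.
Qed.

Lemma sqrnormcJ z : sqrnormc z^*%C = sqrnormc z.
Proof. by case: z => a b; rewrite /sqrnormc/= sqrrN. Qed.

Lemma mulcJ_sqrnormc z : z * z^*%C = (sqrnormc z)%:C.
Proof.
case: z => a b; rewrite /sqrnormc; apply/eqP; rewrite eq_complex ReMc ImMc/=.
by apply/andP; split; apply/eqP; ring.
Qed.

Lemma sqrnormc_normr z : `|z| = 1 -> sqrnormc z = 1.
Proof.
move=> z1; have := mulcJ_sqrnormc z; rewrite -sqr_normc z1 expr1n.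
by move=> /(congr1 (@complex.Re R)).
Qed.

Lemma normr_Re_sqr z : `|complex.Re z| ^+ 2 <= sqrnormc z.
Proof. by rewrite real_normK ?num_real// lerDl sqr_ge0. Qed.

Lemma normr_Re_le z M : 0 <= M -> sqrnormc z <= M ^+ 2 -> `|complex.Re z| <= M.
Proof.
move=> M0 zM; rewrite -(@ler_pXn2r _ 2) ?nnegrE//.
exact: le_trans (normr_Re_sqr z) zM.
Qed.

Lemma normr_Re_le1 z : sqrnormc z = 1 -> `|complex.Re z| <= 1.
Proof. by move=> z1; apply: normr_Re_le => //; rewrite z1 expr1n. Qed.

Lemma conj_mul_pow z (i k : nat) : sqrnormc z = 1 ->
  z ^+ (i + k) * z^*%C ^+ i = z ^+ k.
Proof.
by move=> z1; rewrite addnC exprD -mulrA -exprMn mulcJ_sqrnormc z1 expr1n mulr1.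
Qed.

End complex_parts.

(* The coefficient of order [nu] in the Fourier expansion of [cos^n]. *)
Definition cos_moment (R : realType) (nu n : nat) : R :=
  \sum_(i < n.+1 | (n - i == i + nu)%N) 'C(n, i)%:R / 2 ^+ n.

Section cos_moment.
Variables (R : realType) (nu : nat).

Lemma cos_moment_even k :
  cos_moment R nu (2 * k + nu) = 'C(2 * k + nu, k)%:R / 2 ^+ (2 * k + nu).
Proof.
have kn : (k < (2 * k + nu).+1)%N by lia.
rewrite /cos_moment (bigD1 (Ordinal kn))/=; last by apply/eqP; lia.
rewrite big1 ?addr0// => i /andP[/eqP h] /negP[].
by apply/eqP/val_inj => /=; have := ltn_ord i; lia.
Qed.

Lemma cos_moment_odd k : cos_moment R nu (2 * k + nu).+1 = 0.
Proof.
by rewrite /cos_moment big1// => i /eqP h; exfalso; have := ltn_ord i; lia.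
Qed.

Lemma cos_moment_lt n : (n < nu)%N -> cos_moment R nu n = 0.
Proof.
by move=> nnu; rewrite /cos_moment big1// => i /eqP h; exfalso; have := ltn_ord i; lia.
Qed.

Lemma series_cos_moment (b : R) (K : nat) :
  \sum_(0 <= n < 2 * K + nu) b ^+ n / n`!%:R * cos_moment R nu n =
  series (besselI_coeff nu b) K.
Proof.
elim: K => [|K IH].
  rewrite /series/= (@big_geq _ _ _ 0 0)// big_nat big1// => n /andP[_].
  by rewrite muln0 add0n => /cos_moment_lt ->; rewrite mulr0.
have -> : (2 * K.+1 + nu = (2 * K + nu).+2)%N by lia.
rewrite !big_nat_recr//= IH cos_moment_odd mulr0 addr0 seriesSr; congr (_ + _).
rewrite cos_moment_even /besselI_coeff.
have h := @bin_fact (2 * K + nu) K ltac:(lia).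
have -> : (K + nu = 2 * K + nu - K)%N by lia.
rewrite -h !natrM expr_div_n.
have f0 n : n`!%:R != 0 :> R by rewrite pnatr_eq0 -lt0n fact_gt0.
have c0 : 'C(2 * K + nu, K)%:R != 0 :> R by rewrite pnatr_eq0 -lt0n bin_gt0; lia.
by field; rewrite !f0 c0 expf_neq0.
Qed.

End cos_moment.

Section expR_remainder.
Variable R : realType.

(** The tail is dominated termwise by the tail at [b]. The bound is uniform in [y], so the
    exponential series can be integrated term by term. *)
Lemma expR_remainder (b y : R) (N : nat) : `|y| <= b ->
  `|expR y - \sum_(0 <= n < N) y ^+ n / n`!%:R| <=
  expR b - \sum_(0 <= n < N) b ^+ n / n`!%:R.
Proof.
move=> yb; have b0 : 0 <= b by exact: le_trans yb.
have cy := is_cvg_series_exp_coeff y; have cb := is_cvg_series_exp_coeff b.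
have cy' : (fun n => series (exp_coeff y) (n + N)%N) @ \oo --> expR y.
  by rewrite (cvg_shiftn N (series (exp_coeff y))).
have c1 : (fun n => `|series (exp_coeff y) (n + N)%N - series (exp_coeff y) N|)
    @ \oo --> `|expR y - series (exp_coeff y) N|.
  by apply: cvg_norm; apply: cvgB => //; exact: cvg_cst.
apply: (cvgr_to_le c1); near=> n.
rewrite /series/= (@big_cat_nat _ _ _ N 0 (n + N))//= ?leq_addl// addrAC subrr add0r.
rewrite (le_trans (ler_norm_sum _ _ _))//.
apply: (@le_trans _ _ (\sum_(N <= i < n + N) exp_coeff b i)).
  apply: ler_sum => i _; rewrite /exp_coeff/= normrM normrX.
  rewrite [X in _ * X <= _]ger0_norm ?invr_ge0// ler_wpM2r ?invr_ge0//.
  by rewrite lerXn2r ?nnegrE.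
rewrite lerBrDl -[X in X + _]/(\sum_(0 <= i < N) exp_coeff b i).
rewrite -(@big_cat_nat _ _ _ N 0 (n + N))//= ?leq_addl//.
apply: (@nondecreasing_cvgn_le _ (series (exp_coeff b)))=> //.
by apply/nondecreasing_seqP => k; rewrite seriesSr lerDl divr_ge0// exprn_ge0.
Unshelve. all: by end_near.
Qed.

Lemma cvg_expR_remainder (b : R) :
  (fun N => expR b - \sum_(0 <= n < N) b ^+ n / n`!%:R) @ \oo --> (0 : R).
Proof.
rewrite -[X in _ --> X](subrr (expR b)); apply: cvgB; first exact: cvg_cst.
exact: (is_cvg_series_exp_coeff b).
Qed.

End expR_remainder.

(** * Integrals of bounded functions on sets of finite measure *)

Section bounded_Rintegral.
Variables (R : realType) (d : measure_display) (X : measurableType d).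
Variables (mu : {measure set X -> \bar R}) (D : set X).
Hypotheses (mD : measurable D) (muD : (mu D < +oo)%E).

Lemma bounded_integrable (f : X -> R) (M : R) :
  measurable_fun D f -> (forall x, D x -> `|f x| <= M) ->
  mu.-integrable D (EFin \o f).
Proof.
move=> mf fM; apply: measurable_bounded_integrable => //.
exists M; split; first exact: num_real.
by move=> N MN x Dx; apply: le_trans (fM x Dx) _; exact: ltW.
Qed.

Lemma Rintegral_sum (I : Type) (r : seq I) (Q : pred I) (f : I -> X -> R) :
  (forall i, mu.-integrable D (EFin \o f i)) ->
  Rintegral mu D (fun x => \sum_(i <- r | Q i) f i x) =
  \sum_(i <- r | Q i) Rintegral mu D (f i).
Proof.
move=> intf; elim: r => [|i r IH].
  under eq_Rintegral do rewrite big_nil.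
  by rewrite big_nil Rintegral_cst// mul0r.
under eq_Rintegral do rewrite big_cons.
rewrite big_cons; case: ifP => _ //; rewrite RintegralD//; first by rewrite IH.
rewrite (_ : _ \o _ = (fun x => \sum_(j <- r | Q j) (EFin \o f j) x)%E).
  exact: integrable_sum.
by apply/funext => x /=; rewrite sumEFin.
Qed.

End bounded_Rintegral.

Section complex_measurable.
Variables (R : realType) (d : measure_display) (X : measurableType d).
Variable D : set X.

Definition cmeasurable (f : X -> R[i]) : Prop :=
  measurable_fun D (fun x => complex.Re (f x)) /\
  measurable_fun D (fun x => complex.Im (f x)).

Lemma cmeasurable_cst z : cmeasurable (fun=> z).
Proof. by split; exact: measurable_cst. Qed.

Lemma cmeasurableM f g : cmeasurable f -> cmeasurable g ->
  cmeasurable (fun x => f x * g x).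
Proof.
move=> [f1 f2] [g1 g2]; split.
  under eq_fun do rewrite ReMc.
  by apply: measurable_funB; exact: measurable_funM.
under eq_fun do rewrite ImMc.
by apply: measurable_funD; exact: measurable_funM.
Qed.

Lemma cmeasurableX f n : cmeasurable f -> cmeasurable (fun x => f x ^+ n).
Proof.
move=> mf; elim: n => [|n IH].
  by under eq_fun do rewrite expr0; exact: cmeasurable_cst.
by under eq_fun do rewrite exprS; exact: cmeasurableM.
Qed.

Lemma cmeasurableJ f : cmeasurable f -> cmeasurable (fun x => (f x)^*%C).
Proof.
move=> [f1 f2]; split; first by under eq_fun do rewrite Re_conjc.
have -> : (fun x => complex.Im (f x)^*%C) = (fun x => - complex.Im (f x)).
  by apply/funext => x; case: (f x).
exact: measurable_funN.
Qed.

End complex_measurable.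

Section circle_average.
Variables (R : realType) (d : measure_display) (X : measurableType d).
Variables (mu : {measure set X -> \bar R}) (D : set X) (m : R).
Hypotheses (mD : measurable D) (muD : mu D = m%:E).
Variable u : X -> R[i].
Hypotheses (mu_ : cmeasurable D u) (u1 : forall x, sqrnormc (u x) = 1).
(** Orthogonality of the powers of [u], stated for real integrals: the arbitrary factor [w] gives
    access to the real and the imaginary part at once. It is used for the angle on [0, 2 pi] with
    [m = 2 * pi] and for Haar measure with [m = 1]. *)
Hypothesis moments : forall (w : R[i]) (a b : nat),
  Rintegral mu D (fun x => complex.Re (w * (u x ^+ a * (u x)^*%C ^+ b))) =
  if a == b then m * complex.Re w else 0.

Let muDoo : (mu D < +oo)%E. Proof. by rewrite muD ltry. Qed.

Let sqr1 a b x : sqrnormc (u x ^+ a * (u x)^*%C ^+ b) = 1.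
Proof. by rewrite sqrnormcM !sqrnormcX sqrnormcJ !u1 !expr1n mulr1. Qed.

Let Re_bound w a b x :
  `|complex.Re (w * (u x ^+ a * (u x)^*%C ^+ b))| <= 1 + sqrnormc w.
Proof.
have w0 : 0 <= sqrnormc w by rewrite addr_ge0 ?sqr_ge0.
apply: normr_Re_le; first by rewrite addr_ge0.
by rewrite sqrnormcM sqr1 mulr1; nra.
Qed.

Let mRe w a b :
  measurable_fun D (fun x => complex.Re (w * (u x ^+ a * (u x)^*%C ^+ b))).
Proof.
suff [] : cmeasurable D (fun x => w * (u x ^+ a * (u x)^*%C ^+ b)) by [].
apply: cmeasurableM; first exact: cmeasurable_cst.
apply: cmeasurableM; first exact: cmeasurableX.
by apply: cmeasurableX; exact: cmeasurableJ.
Qed.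

Let intRe w a b : mu.-integrable D
  (EFin \o (fun x => complex.Re (w * (u x ^+ a * (u x)^*%C ^+ b)))).
Proof. by apply: bounded_integrable => // x _; exact: Re_bound. Qed.

Variable v : R[i].
Hypothesis v1 : sqrnormc v = 1.

(** The real part is half the sum of a number and its conjugate. In the binomial expansion of the
    power the moments retain only the index with [n - i = i + nu], where the powers of [v] and its
    conjugate combine to [v ^+ nu]. *)
Lemma circle_average_powers (w : R[i]) (nu n : nat) :
  Rintegral mu D (fun x => complex.Re (w * (u x)^*%C ^+ nu) *
    complex.Re (u x * v) ^+ n) =
  m * complex.Re (w * v ^+ nu) * cos_moment R nu n.
Proof.
have expand x : complex.Re (w * (u x)^*%C ^+ nu) * complex.Re (u x * v) ^+ n =
  \sum_(i < n.+1) complex.Re ((('C(n, i)%:R / 2 ^+ n)%:C *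
    (w * (v ^+ (n - i) * v^*%C ^+ i))) *
     (u x ^+ (n - i) * (u x)^*%C ^+ (i + nu))).
  rewrite mulrC -Re_real_mul.
  have -> : (complex.Re (u x * v) ^+ n)%:C = ((u x * v + (u x * v)^*%C) / 2) ^+ n.
    by rewrite -ReJ_add rmorphXn.
  rewrite expr_div_n exprDn !mulr_suml Re_sum.
  apply: eq_bigr => i _; congr complex.Re.
  rewrite rmorphM/= !exprMn exprD -mulr_natr.
  have -> : ('C(n, i)%:R / 2 ^+ n)%:C = 'C(n, i)%:R / 2 ^+ n :> R[i].
    by rewrite rmorphM fmorphV rmorphXn/= !rmorph_nat.
  by ring.
under eq_Rintegral do rewrite expand.
rewrite Rintegral_sum//.
under eq_bigr do rewrite moments.
rewrite -big_mkcond/= /cos_moment mulr_sumr; apply: eq_bigr => i /eqP ni.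
rewrite Re_real_mul ni conj_mul_pow//.
by rewrite -[RHS]mulrA; congr (_ * _); exact: mulrC.
Qed.

Lemma circle_average_besselI (w : R[i]) (nu : nat) (b : R) :
  Rintegral mu D (fun x => complex.Re (w * (u x)^*%C ^+ nu) *
    expR (b * complex.Re (u x * v))) =
  m * complex.Re (w * v ^+ nu) * besselI nu b.
Proof.
have m0 : 0 <= m by rewrite -lee_fin -muD measure_ge0.
pose g x := complex.Re (w * (u x)^*%C ^+ nu).
pose r x := complex.Re (u x * v).
have gE x : g x = complex.Re (w * (u x ^+ 0 * (u x)^*%C ^+ nu)).
  by rewrite expr0 mul1r.
have mg : measurable_fun D g by rewrite (funext gE).
have mr : measurable_fun D r.
  suff [] : cmeasurable D (fun x => u x * v) by [].
  by apply: cmeasurableM => //; exact: cmeasurable_cst.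
pose B := 1 + sqrnormc w.
have gB x : `|g x| <= B by rewrite gE; exact: Re_bound.
have B0 : 0 <= B by rewrite !addr_ge0 ?sqr_ge0.
have r1 x : `|r x| <= 1.
  by apply: normr_Re_le1; rewrite sqrnormcM u1 v1 mulr1.
have br x : `|b * r x| <= `|b| by rewrite normrM ler_piMr.
have mexp : measurable_fun D (fun x => g x * expR (b * r x)).
  apply: measurable_funM => //; apply: measurableT_comp => //.
  by apply: measurable_funM => //; exact: measurable_cst.
have expb x : expR (b * r x) <= expR `|b|.
  by rewrite ler_expR (le_trans (ler_norm _)).
have iexp : mu.-integrable D (EFin \o (fun x => g x * expR (b * r x))).
  apply: (@bounded_integrable _ _ _ _ _ mD muDoo _ (B * expR `|b|)) => // x _.
  by rewrite normrM ler_pM// gtr0_norm ?expR_gt0.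
have mpow n : measurable_fun D (fun x => g x * r x ^+ n).
  by apply: measurable_funM => //; exact: measurable_funX.
have ipow n : mu.-integrable D (EFin \o (fun x => g x * r x ^+ n)).
  apply: (@bounded_integrable _ _ _ _ _ mD muDoo _ (B * 1)) => // x _.
  by rewrite normrM ler_pM// normrX exprn_ile1.
pose S N x := \sum_(0 <= n < N) b ^+ n / n`!%:R * (g x * r x ^+ n).
have iS' n : mu.-integrable D
    (EFin \o (fun x => b ^+ n / n`!%:R * (g x * r x ^+ n))).
  exact: (integrableZl mD (b ^+ n / n`!%:R) (ipow n)).
have iS N : mu.-integrable D (EFin \o S N).
  rewrite (_ : _ \o _ = (fun x => \sum_(0 <= n < N)
    (b ^+ n / n`!%:R * (g x * r x ^+ n))%:E)%E).
    by apply: integrable_sum => // n _; exact: iS'.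
  by apply/funext => x /=; rewrite sumEFin.
have intS N : Rintegral mu D (S N) = m * complex.Re (w * v ^+ nu) *
    \sum_(0 <= n < N) b ^+ n / n`!%:R * cos_moment R nu n.
  rewrite /S Rintegral_sum// mulr_sumr; apply: eq_bigr => n _.
  by rewrite RintegralZl// circle_average_powers mulrCA.
(* Replacing the exponential by its partial sum changes the integrand by at most [B] times the
   remainder at [|b|], uniformly on [D]; integration adds the factor [m]. *)
have diff N : `|Rintegral mu D (fun x => g x * expR (b * r x)) -
    m * complex.Re (w * v ^+ nu) *
    \sum_(0 <= n < N) b ^+ n / n`!%:R * cos_moment R nu n| <=
    B * (expR `|b| - \sum_(0 <= n < N) `|b| ^+ n / n`!%:R) * m.
  have iD : mu.-integrable D (EFin \o (fun x => g x * expR (b * r x) - S N x)).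
    exact: (integrableB mD iexp (iS N)).
  rewrite -intS -RintegralB//; last exact: iS.
  apply: le_trans (le_normr_Rintegral mD _) _.
    exact: iD.
  rewrite -[m]/(fine m%:E) -muD -Rintegral_cst//.
  apply: le_Rintegral => //.
  - exact: integrable_norm.
  - apply: (@bounded_integrable _ _ _ _ _ mD muDoo _
      `|B * (expR `|b| - \sum_(0 <= n < N) `|b| ^+ n / n`!%:R)|) => //.
  move=> x _; rewrite /S.
  have -> : \sum_(0 <= n < N) b ^+ n / n`!%:R * (g x * r x ^+ n) =
     g x * \sum_(0 <= n < N) (b * r x) ^+ n / n`!%:R.
    by rewrite mulr_sumr; apply: eq_bigr => n _; rewrite exprMn; ring.
  rewrite -mulrBr normrM ler_pM//; exact: expR_remainder.
have lim1 : (fun K => m * complex.Re (w * v ^+ nu) *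
    series (besselI_coeff nu b) K) @ \oo -->
    m * complex.Re (w * v ^+ nu) * besselI nu b.
  by apply: cvgMr; exact: is_cvg_besselI.
rewrite -(cvg_lim _ lim1)//; apply/esym/cvg_lim => //.
apply/cvgrPdist_le => e e0.
have c0 : (fun N => B * (expR `|b| - \sum_(0 <= n < N) `|b| ^+ n / n`!%:R) * m)
    @ \oo --> B * 0 * m.
  by apply: cvgMl; apply: cvgMr; exact: cvg_expR_remainder.
rewrite mulr0 mul0r in c0.
have /cvgrPdist_le/(_ e e0) := c0; apply: filterS => K.
rewrite sub0r normrN => hK.
rewrite -series_cos_moment (le_trans (diff _))//.
apply: le_trans (le_trans (ler_norm _) hK).
(* The remainder after [2 * K + nu] terms is at most the one after [K] terms, which tends to 0. *)
rewrite ler_wpM2r// ler_wpM2l// lerD2l lerN2.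
rewrite [leRHS](@big_cat_nat _ _ _ K)//=; last by lia.
by rewrite lerDl sumr_ge0// => i _; rewrite divr_ge0// exprn_ge0.
Qed.

End circle_average.

(** * Haar measure on U(1) *)

Definition cis (R : realType) (x : R) : R[i] := cos x +i* sin x.

Section cis.
Variable R : realType.

Lemma cisD (x y : R) : cis (x + y) = cis x * cis y.
Proof.
apply/eqP; rewrite eq_complex ReMc ImMc/= cosD sinD.
by apply/andP; split; apply/eqP; ring.
Qed.

Lemma cis0 : cis 0 = 1 :> R[i].
Proof. by rewrite /cis cos0 sin0. Qed.

Lemma conjc_cis (x : R) : (cis x)^*%C = cis (- x).
Proof. by rewrite /cis/= cosN sinN. Qed.

Lemma sqrnormc_cis (x : R) : sqrnormc (cis x) = 1.
Proof. exact: cos2Dsin2. Qed.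

Lemma cisX (x : R) n : cis x ^+ n = cis (n%:R * x).
Proof.
elim: n => [|n IH]; first by rewrite mul0r cis0.
by rewrite exprS IH -cisD -nat1r mulrDl mul1r.
Qed.

Lemma cispi : cis pi = -1 :> R[i].
Proof. by apply/eqP; rewrite eq_complex/= cospi sinpi oppr0 !eqxx. Qed.

Lemma cis2pi : cis (2 * pi) = 1 :> R[i].
Proof. by rewrite mulr_natl mulr2n cisD cispi mulrNN mulr1. Qed.

Lemma cis_powers (x : R) a b :
  cis x ^+ a * (cis x)^*%C ^+ b = cis ((a%:R - b%:R) * x).
Proof. by rewrite conjc_cis !cisX -cisD mulrBl mulrN. Qed.

Lemma normr_cis (x : R) : `|cis x| = 1.
Proof. by rewrite normc_def /= cos2Dsin2 sqrtr1. Qed.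

Lemma continuous_cos_mul (k : R) : continuous (fun x : R => cos (k * x)).
Proof.
move=> x; apply: continuous_comp; last exact: continuous_cos.
exact: mulrl_continuous.
Qed.

Lemma continuous_sin_mul (k : R) : continuous (fun x : R => sin (k * x)).
Proof.
move=> x; apply: continuous_comp; last exact: continuous_sin.
exact: mulrl_continuous.
Qed.

Lemma cmeasurable_cis (D : set R) : cmeasurable D (@cis R).
Proof.
split; apply: (measurable_funS measurableT (subsetT D)) => //=.
  by apply: continuous_measurable_fun; exact: continuous_cos.
by apply: continuous_measurable_fun; exact: continuous_sin.
Qed.

Lemma cis_moments (w : R[i]) (a b : nat) :
  Rintegral (@lebesgue_measure R) `[0, 2 * pi]
    (fun x => complex.Re (w * (cis x ^+ a * (cis x)^*%C ^+ b))) =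
  if a == b then 2 * pi * complex.Re w else 0.
Proof.
have pi2 : 0 < 2 * pi :> R by rewrite mulr_gt0// pi_gt0.
case: (eqVneq a b) => [->|ab].
  under eq_Rintegral do rewrite -exprMn mulcJ_sqrnormc sqrnormc_cis expr1n mulr1.
  rewrite Rintegral_cst//= lebesgue_measure_itv/= lte_fin pi2 -EFinB subr0/=.
  by rewrite mulrC.
pose k : R := a%:R - b%:R.
have k0 : k != 0 by rewrite subr_eq0 eqr_nat.
pose A := complex.Re w; pose B := complex.Im w.
have fE x : complex.Re (w * (cis x ^+ a * (cis x)^*%C ^+ b)) =
    A * cos (k * x) - B * sin (k * x).
  by rewrite cis_powers ReMc.
under eq_Rintegral do rewrite fE.
(* A primitive of the integrand, available since [k != 0]; it takes the same value at 0 and at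
   [2 * pi]. *)
pose F (x : R) := k^-1 * (A * sin (k * x) + B * cos (k * x)).
have dF (x : R) : is_derive x 1 F (A * cos (k * x) - B * sin (k * x)).
  rewrite /F; apply: is_derive_eq.
  rewrite /GRing.scale/=.
  by field.
have cf : continuous (fun x : R => A * cos (k * x) - B * sin (k * x)).
  move=> x; apply: cvgB; apply: cvgMr; first exact: continuous_cos_mul.
  exact: continuous_sin_mul.
have cF : continuous F.
  by move=> x; apply: differentiable_continuous; apply/derivable1_diffP; case: (dF x).
rewrite /Rintegral (@continuous_FTC2 _ _ F)//=; last 3 first.
- exact: continuous_subspaceT.
- split.
  + by move=> x _; case: (dF x).
  + by apply: cvg_at_right_filter; exact: cF.
  + by apply: cvg_at_left_filter; exact: cF.
- by move=> x _; rewrite derive1E; exact: derive_val.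
(* As [k] is a difference of naturals in [R], periodicity is read off from powers of
   [cis (2 * pi) = 1]. *)
have : cis (k * (2 * pi)) = 1 by rewrite -cis_powers cis2pi conjc1 !expr1n mulr1.
rewrite /cis => -[c1 s0].
rewrite /F c1 s0 !mulr0 sin0 cos0; ring.
Qed.

End cis.

Section haar.
Variables (R : realType).

Lemma measurable_U1_coord : measurable_fun setT (@U1_coord R).
Proof. by move=> _ B mB; exists B. Qed.

Lemma cmeasurable_U1 : cmeasurable setT (fun V : U1 R => sval V).
Proof.
split.
  exact: (measurableT_comp (@measurable_fst _ _ R R) measurable_U1_coord).
exact: (measurableT_comp (@measurable_snd _ _ R R) measurable_U1_coord).
Qed.

Lemma sqrnormc_U1 (V : U1 R) : sqrnormc (sval V) = 1.
Proof. by apply: sqrnormc_normr; case: V => /= z /eqP. Qed.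

Lemma measurable_U1_mul (h : U1 R) : measurable_fun setT (U1_mul h).
Proof.
have mh : measurable_fun setT (fun V => U1_coord (U1_mul h V)).
  have [mRe mIm] := cmeasurableM (cmeasurable_cst setT (sval h)) cmeasurable_U1.
  by apply: measurable_fun_pair.
move=> _ _ [B mB <-]; rewrite !setTI.
by have := mh measurableT B mB; rewrite setTI.
Qed.

(** The translated integral is the integral against the pushforward of [mu], which agrees with [mu]
    on measurable sets. The bound [M] supplies integrability. *)
Lemma haar_Rintegral_mul (mu : probability (U1 R) R) (h : U1 R) (f : U1 R -> R)
    (M : R) : is_haar_U1 mu -> measurable_fun setT f ->
  (forall V, `|f V| <= M) ->
  Rintegral mu setT (fun V => f (U1_mul h V)) = Rintegral mu setT f.
Proof.
move=> hmu mf fM; have mh := measurable_U1_mul h.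
rewrite /Rintegral; congr fine.
have := @integral_pushforward _ _ _ _ R _ mh mu setT (EFin \o f).
rewrite preimage_setT => <-//; last 2 first.
- exact/measurable_EFinP.
- have mT : (mu setT < +oo)%E by rewrite probability_setT ltry.
  by apply: (@bounded_integrable _ _ _ mu _ measurableT mT (f \o U1_mul h) M);
    [exact: measurableT_comp|move=> V _; exact: fM].
apply: eq_measure_integral => A mA _; exact: (hmu h A mA).
Qed.

(** A suitable rotation reverses the sign of an off-diagonal moment, so invariance makes it vanish.
    The factor [1 *] is the total mass, in the shape that [moments] expects. *)
Lemma haar_moments (mu : probability (U1 R) R) (w : R[i]) (a b : nat) :
  is_haar_U1 mu ->
  Rintegral mu setT (fun V => complex.Re (w * (sval V ^+ a * (sval V)^*%C ^+ b))) =
  if a == b then 1 * complex.Re w else 0.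
Proof.
move=> hmu; case: (eqVneq a b) => [->|ab].
  under eq_Rintegral do rewrite -exprMn mulcJ_sqrnormc sqrnormc_U1 expr1n mulr1.
  rewrite Rintegral_cst// mulrC; congr (_ * _).
  exact: (congr1 fine (probability_setT mu)).
pose g (V : U1 R) := complex.Re (w * (sval V ^+ a * (sval V)^*%C ^+ b)).
have mg : measurable_fun setT g.
  suff [] : cmeasurable setT (fun V : U1 R => w * (sval V ^+ a * (sval V)^*%C ^+ b)) by [].
  apply: cmeasurableM; first exact: cmeasurable_cst.
  apply: cmeasurableM; first by apply: cmeasurableX; exact: cmeasurable_U1.
  by apply: cmeasurableX; apply: cmeasurableJ; exact: cmeasurable_U1.
have w0 : 0 <= sqrnormc w by rewrite addr_ge0 ?sqr_ge0.
have gM V : `|g V| <= 1 + sqrnormc w.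
  apply: normr_Re_le; first by rewrite addr_ge0.
  rewrite !sqrnormcM !sqrnormcX sqrnormcJ sqrnormc_U1 !expr1n !mulr1.
  by nra.
(* Rotation by this angle multiplies [V^a conj(V)^b] by [-1]. *)
pose x : R := pi / (a%:R - b%:R).
have hx : `|cis x| == 1 by rewrite normr_cis.
pose h : U1 R := exist _ (cis x) hx.
have gh V : g (U1_mul h V) = -1 * g V.
  rewrite /g /= rmorphM !exprMn.
  have -> : w * (cis x ^+ a * sval V ^+ a * ((cis x)^*%C ^+ b * (sval V)^*%C ^+ b))
    = (cis x ^+ a * (cis x)^*%C ^+ b) * (w * (sval V ^+ a * (sval V)^*%C ^+ b)).
    by ring.
  have xpi : (a%:R - b%:R) * x = pi.
    by rewrite /x mulrC mulfVK// subr_eq0 eqr_nat.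
  rewrite cis_powers xpi.
  by rewrite cispi !mulN1r; case: (w * _).
have ig : mu.-integrable setT (EFin \o g).
  have mT : (mu setT < +oo)%E by rewrite probability_setT ltry.
  exact: (@bounded_integrable _ _ _ mu _ measurableT mT g _ mg (fun V _ => gM V)).
have := haar_Rintegral_mul h hmu mg gM.
under eq_Rintegral do rewrite gh.
by rewrite RintegralZl//; lra.
Qed.

End haar.

(** * The partition function *)

(** Extending [f] by zero outside [D] times the second space reduces this to the theorem on the full
    product, where boundedness and finite mass give integrability. *)
Lemma bounded_Fubini (R : realType) (d1 d2 : measure_display)
    (X : measurableType d1) (Y : measurableType d2)
    (m1 : {sigma_finite_measure set X -> \bar R})
    (m2 : {sigma_finite_measure set Y -> \bar R}) (D : set X)
    (f : X * Y -> R) (M : R) :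
  measurable D -> (m1 D < +oo)%E -> (m2 setT < +oo)%E ->
  measurable_fun setT f -> (forall z, `|f z| <= M) ->
  Rintegral m1 D (fun x => Rintegral m2 setT (fun y => f (x, y))) =
  Rintegral m2 setT (fun y => Rintegral m1 D (fun x => f (x, y))).
Proof.
move=> mD m1D m2T mf fM.
have mfx x : measurable_fun setT (fun y => f (x, y)).
  exact: (measurableT_comp mf (measurable_pair1 x)).
have mfy y : measurable_fun setT (fun x => f (x, y)).
  exact: (measurableT_comp mf (measurable_pair2 y)).
have ix x : m2.-integrable setT (EFin \o (fun y => f (x, y))).
  exact: (@bounded_integrable _ _ _ m2 _ measurableT m2T _ M).
have iy y : m1.-integrable D (EFin \o (fun x => f (x, y))).
  apply: (@bounded_integrable _ _ _ m1 _ mD m1D _ M) => //.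
  exact: measurable_funTS.
pose A : set (X * Y) := D `*` setT.
have mA : measurable A by exact: measurableX.
have mA_fin : ((m1 \x m2)%E A < +oo)%E.
  by rewrite product_measure1E// lte_mul_pinfty ?measure_ge0// ge0_fin_numE.
pose F : X * Y -> \bar R := (EFin \o f) \_ A.
have iF : (m1 \x m2)%E.-integrable setT F.
  rewrite /F -integrable_mkcond//.
  by apply: (@bounded_integrable _ _ _ _ _ mA mA_fin _ M) => //; exact: measurable_funTS.
have /= := Fubini iF.
have EL : (\int[m1]_x \int[m2]_y F (x, y))%E =
    (\int[m1]_(x in D) (Rintegral m2 setT (fun y => f (x, y)))%:E)%E.
  rewrite [RHS]integral_mkcond; apply: eq_integral => x _.
  rewrite patchE; case: ifPn => xD.
    rewrite /Rintegral fineK; last exact: integrable_fin_num (ix x).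
    apply: eq_integral => y _; rewrite /F patchE mem_set//.
    by split => //; exact: set_mem.
  apply: integral0_eq => y _; rewrite /F patchE memNset// => -[/mem_set].
  by rewrite (negbTE xD).
have ER : (\int[m2]_y \int[m1]_x F (x, y))%E =
    (\int[m2]_y (Rintegral m1 D (fun x => f (x, y)))%:E)%E.
  apply: eq_integral => y _.
  rewrite /Rintegral fineK; last exact: integrable_fin_num (iy y).
  rewrite [RHS]integral_mkcond; apply: eq_integral => x _.
  rewrite /F !patchE; congr (if _ then _ else _).
  by apply/idP/idP => [/set_mem[xD _]|/set_mem xD]; exact: mem_set.
by rewrite EL ER => h; rewrite /Rintegral h.
Qed.

Lemma cmeasurable_comp (R : realType) (d1 d2 : measure_display)
    (X : measurableType d1) (Y : measurableType d2) (f : Y -> R[i]) (g : X -> Y) :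
  cmeasurable setT f -> measurable_fun setT g ->
  cmeasurable setT (fun x => f (g x)).
Proof.
move=> [f1 f2] mg; split; [exact: (measurableT_comp f1 mg)|
  exact: (measurableT_comp f2 mg)].
Qed.

(** The circle average with [u] the conjugate of [V] and [v = 1]: conjugating turns the negative
    power of [u] into [V ^+ nu]. *)
Lemma haar_besselI (R : realType) (dV : probability (U1 R) R) (w : R[i])
    (nu : nat) (t : R) : is_haar_U1 dV ->
  Rintegral dV setT (fun V => complex.Re (w * sval V ^+ nu) *
    expR (t * complex.Re (sval V))) = complex.Re w * besselI nu t.
Proof.
move=> hdV.
have := @circle_average_besselI R _ _ dV setT 1 measurableT (probability_setT dV)
  (fun V => (sval V)^*%C) _ _ _ 1 (sqrnormc1 R) w nu t.
rewrite expr1n mulr1 mul1r => <-.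
- by apply: eq_Rintegral => V _; rewrite conjcK mulr1 Re_conjc.
- by apply: cmeasurableJ; exact: cmeasurable_U1.
- by move=> V; rewrite sqrnormcJ sqrnormc_U1.
move=> w' a b; under eq_Rintegral do rewrite conjcK mulrC.
under eq_Rintegral do rewrite mulrC (mulrC (_^*%C ^+ _)).
by rewrite haar_moments// eq_sym.
Qed.

Section Zeff.
Variables (R : realType) (dV : probability (U1 R) R).
Hypothesis hdV : is_haar_U1 dV.
Variables (nu : nat) (s t : R).

(** The integrand after the rotation of [V]. Taking [w = 1] gives its real part and [w = - 'i] its
    imaginary part. *)
Definition Zeff_density (w : R[i]) (theta : R) (V : U1 R) : R :=
  complex.Re (w * (cis theta)^*%C ^+ nu) *
  expR (t * complex.Re (sval V) + s * complex.Re (cis theta * sval V)).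

Lemma measurable_Zeff_density (w : R[i]) :
  measurable_fun setT (fun z : R * U1 R => Zeff_density w z.1 z.2).
Proof.
have mc : cmeasurable setT (fun z : R * U1 R => cis z.1).
  exact: (cmeasurable_comp (cmeasurable_cis _) measurable_fst).
have mV : cmeasurable setT (fun z : R * U1 R => sval z.2).
  exact: (cmeasurable_comp (cmeasurable_U1 R) measurable_snd).
apply: measurable_funM.
  suff [] : cmeasurable setT (fun z : R * U1 R => w * (cis z.1)^*%C ^+ nu) by [].
  apply: cmeasurableM; first exact: cmeasurable_cst.
  by apply: cmeasurableX; exact: cmeasurableJ.
apply: measurableT_comp => //; apply: measurable_funD.
  by apply: measurable_funM; [exact: measurable_cst|case: mV].
apply: measurable_funM; first exact: measurable_cst.
by have [] := cmeasurableM mc mV.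
Qed.

Lemma Zeff_density_bound (w : R[i]) theta V :
  `|Zeff_density w theta V| <= (1 + sqrnormc w) * expR (`|t| + `|s|).
Proof.
have w0 : 0 <= sqrnormc w by rewrite addr_ge0 ?sqr_ge0.
rewrite normrM ler_pM//.
  apply: normr_Re_le; first by rewrite addr_ge0.
  rewrite sqrnormcM sqrnormcX sqrnormcJ sqrnormc_cis expr1n mulr1.
  by nra.
rewrite gtr0_norm ?expR_gt0// ler_expR lerD// (le_trans (ler_norm _))//.
  by rewrite normrM ler_piMr// normr_Re_le1// sqrnormc_U1.
by rewrite normrM ler_piMr// normr_Re_le1// sqrnormcM sqrnormc_cis sqrnormc_U1 mulr1.
Qed.

(** With the integrals exchanged, the angular average at fixed [V] produces [sval V ^+ nu] and
    [besselI nu s]; the Haar average of the rest produces [besselI nu t]. *)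
Lemma Zeff_density_average (w : R[i]) :
  Rintegral (@lebesgue_measure R) `[0, 2 * pi]
    (fun theta => Rintegral dV setT (Zeff_density w theta)) =
  2 * pi * (complex.Re w * (besselI nu t * besselI nu s)).
Proof.
have pi2 : 0 < 2 * pi :> R by rewrite mulr_gt0// pi_gt0.
have leb : lebesgue_measure (`[0, 2 * pi] : set R) = (2 * pi)%:E.
  by rewrite lebesgue_measure_itv/= lte_fin pi2 -EFinB subr0.
have lebfin : (lebesgue_measure (`[0%R, (2 * pi)%R] : set R) < +oo)%E.
  by rewrite leb ltry.
have dVfin : (dV setT < +oo)%E by rewrite probability_setT ltry.
have -> : Rintegral (@lebesgue_measure R) `[0, 2 * pi]
    (fun theta => Rintegral dV setT (Zeff_density w theta)) =
  Rintegral dV setT (fun V => Rintegral (@lebesgue_measure R) `[0, 2 * pi]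
    (fun theta => Zeff_density w theta V)).
  apply: (@bounded_Fubini _ _ _ _ _ (@lebesgue_measure R) dV _
    (fun z : R * U1 R => Zeff_density w z.1 z.2)
    ((1 + sqrnormc w) * expR (`|t| + `|s|))) => //.
  - exact: measurable_Zeff_density.
  - by move=> z; exact: Zeff_density_bound.
have inner V : Rintegral (@lebesgue_measure R) `[0, 2 * pi]
    (fun theta => Zeff_density w theta V) =
  complex.Re ((2 * pi * besselI nu s)%:C * w * sval V ^+ nu) *
    expR (t * complex.Re (sval V)).
  have := @circle_average_besselI R _ _ (@lebesgue_measure R) `[0, 2 * pi]
    (2 * pi) (measurable_itv _) leb (@cis R) (cmeasurable_cis _)
    (@sqrnormc_cis R) (@cis_moments R) (sval V) (sqrnormc_U1 V)
    ((expR (t * complex.Re (sval V)))%:C * w) nu s.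
  rewrite -!mulrA !Re_real_mul => h.
  apply: etrans (etrans h _); last by ring.
  apply: eq_Rintegral => theta _.
  by rewrite /Zeff_density -mulrA Re_real_mul expRD; ring.
under eq_Rintegral do rewrite inner.
by rewrite haar_besselI// Re_real_mul; ring.
Qed.

(** Invariance undoes the rotation by [h], and the normalization [k] moves into [w]. *)
Lemma Zeff_density_scaled (w : R[i]) (k theta : R) (h : U1 R) :
  k * Rintegral dV setT (fun V => Zeff_density w theta (U1_mul h V)) =
  Rintegral dV setT (Zeff_density (k%:C * w) theta).
Proof.
have mdens : measurable_fun setT (Zeff_density w theta).
  exact: (measurableT_comp (measurable_Zeff_density w) (measurable_pair1 theta)).
have dVfin : (dV setT < +oo)%E by rewrite probability_setT ltry.
rewrite (haar_Rintegral_mul h hdV mdens (Zeff_density_bound w theta)).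
rewrite -RintegralZl//; last first.
  exact: (@bounded_integrable _ _ _ dV _ measurableT dVfin _ _ mdens
    (fun V _ => Zeff_density_bound w theta V)).
by apply: eq_Rintegral => V _; rewrite /Zeff_density -mulrA Re_real_mul mulrA.
Qed.

End Zeff.

Lemma cexp_polar (R : realType) (a b : R) :
  cexp ('i%C * b%:C - a%:C) = (expR (- a))%:C * cis b.
Proof.
suff -> : 'i%C * b%:C - a%:C = (- a) +i* b by [].
by apply/eqP; rewrite eq_complex/= !(mul0r, mul1r, subr0, add0r, sub0r, oppr0, addr0) !eqxx.
Qed.

Lemma cexp_imaginary (R : realType) (x : R) : cexp ('i%C * x%:C) = cis x.
Proof. by have := cexp_polar 0 x; rewrite subr0 oppr0 expR0 mul1r. Qed.

(** In terms of [h V] with [h] the phase of angle [- (theta / 2)], the left source multiplies [h V]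
    itself and the right source the product of [cis theta] and [h V], so the half angles
    disappear. *)
Lemma Zeff_integrandE (R : realType) (nu : nat) (V4 Phi jL jR theta : R)
    (V : U1 R) (h : U1 R) : sval h = cis (- (theta / 2)) ->
  Zeff_integrand nu V4 Phi jL jR theta V =
  (expR (- (2 * V4 * Phi * jL) * complex.Re (sval (U1_mul h V)) +
    2 * V4 * Phi * jR * complex.Re (cis theta * sval (U1_mul h V))))%:C *
  (cis theta)^*%C ^+ nu.
Proof.
move=> hE; rewrite /Zeff_integrand.
have -> : - 'i%C * (theta / 2)%:C = 'i%C * (- (theta / 2))%:C :> R[i].
  by rewrite rmorphN mulrN mulNr.
rewrite !cexp_imaginary.
have -> : - 'i%C * (nu%:R * theta)%:C = 'i%C * (nu%:R * - theta)%:C :> R[i].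
  by rewrite mulrN rmorphN mulrN mulNr.
rewrite conjc_cis cisX /=.
have -> : (jL%:C * cis (- (theta / 2)) - jR%:C * cis (theta / 2)) * sval V =
   jL%:C * (sval h * sval V) - jR%:C * (cis theta * (sval h * sval V)).
  rewrite hE (mulrA (cis theta)) -cisD (_ : theta + - (theta / 2) = theta / 2).
    by ring.
  by field.
set A := sval h * sval V; set B := cis theta * A.
have ReB z w : complex.Re (z - w) = complex.Re z - complex.Re w :> R.
  by case: z; case: w.
rewrite ReB !Re_real_mul.
rewrite cexp_polar; congr (_%:C * _).
by rewrite /= -/A -/B; congr expR; ring.
Qed.

Theorem ZeffE (R : realType) (dV : probability (U1 R) R) (nu : nat)
    (V4 Phi jL jR : R) : is_haar_U1 dV ->
  Zeff dV nu V4 Phi jL jR =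
  (besselI nu (- (2 * V4 * Phi * jL)) * besselI nu (2 * V4 * Phi * jR))%:C.
Proof.
move=> hdV; set t := - (2 * V4 * Phi * jL); set s := 2 * V4 * Phi * jR.
have pi2 : 2 * pi != 0 :> R by rewrite mulf_neq0 ?pnatr_eq0// gt_eqF// pi_gt0.
have hx theta : `|cis (- (theta / 2)) : R[i]| == 1 by rewrite normr_cis.
pose h theta : U1 R := exist _ (cis (- (theta / 2))) (hx theta).
have intE theta V : Zeff_integrand nu V4 Phi jL jR theta V =
    (expR (t * complex.Re (sval (U1_mul (h theta) V)) +
      s * complex.Re (cis theta * sval (U1_mul (h theta) V))))%:C *
    (cis theta)^*%C ^+ nu.
  exact: Zeff_integrandE.
have ImE (z : R[i]) : complex.Im z = complex.Re (- 'i%C * z).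
  by case: z => a b; rewrite ReMc /= oppr0 mul0r sub0r mulN1r opprK.
have Re_int theta : Rintegral dV setT
    (fun V => complex.Re (Zeff_integrand nu V4 Phi jL jR theta V)) =
    Rintegral dV setT (fun V => Zeff_density nu s t 1 theta (U1_mul (h theta) V)).
  apply: eq_Rintegral => V _.
  by rewrite intE Re_real_mul /Zeff_density mul1r mulrC.
have Im_int theta : Rintegral dV setT
    (fun V => complex.Im (Zeff_integrand nu V4 Phi jL jR theta V)) =
    Rintegral dV setT
      (fun V => Zeff_density nu s t (- 'i%C) theta (U1_mul (h theta) V)).
  apply: eq_Rintegral => V _.
  by rewrite ImE intE mulrCA Re_real_mul /Zeff_density mulrC.
have Im_real_mul (k : R) (z : R[i]) : complex.Im (k%:C * z) = k * complex.Im z.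
  by case: z => a b; rewrite ImMc /= mul0r addr0.
have ReE : complex.Re (Zeff dV nu V4 Phi jL jR) =
    Rintegral (@lebesgue_measure R) `[0, 2 * pi] (fun theta => complex.Re
      ((2 * pi)^-1%:C * Cintegral dV setT (Zeff_integrand nu V4 Phi jL jR theta))).
  by [].
have ImE' : complex.Im (Zeff dV nu V4 Phi jL jR) =
    Rintegral (@lebesgue_measure R) `[0, 2 * pi] (fun theta => complex.Im
      ((2 * pi)^-1%:C * Cintegral dV setT (Zeff_integrand nu V4 Phi jL jR theta))).
  by [].
apply/eqP; rewrite eq_complex ReE ImE'; apply/andP; split; apply/eqP.
  transitivity (Rintegral (@lebesgue_measure R) `[0, 2 * pi]
    (fun theta => Rintegral dV setT
      (Zeff_density nu s t (((2 * pi)^-1)%:C * 1) theta))).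
    apply: eq_Rintegral => theta _.
    by rewrite Re_real_mul [complex.Re _]Re_int Zeff_density_scaled.
  by rewrite Zeff_density_average// mulr1 /= mulrA mulfV// mul1r.
transitivity (Rintegral (@lebesgue_measure R) `[0, 2 * pi]
    (fun theta => Rintegral dV setT
      (Zeff_density nu s t (((2 * pi)^-1)%:C * - 'i%C) theta))).
  apply: eq_Rintegral => theta _.
  by rewrite Im_real_mul [complex.Im _]Im_int Zeff_density_scaled.
(* The imaginary part carries the real part of [- 'i] as a factor, which is 0. *)
by rewrite Zeff_density_average// Re_real_mul /= oppr0 mulr0 mul0r mulr0.
Qed.

(** * Sum rules for the inverse singular values *)

Theorem mainTheorem4 (R : realType) (nu : nat) (V4 Phi : R)
    (hV4 : 0 < V4) (hPhi : 0 < Phi)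
    (dV : probability (U1 R) R) (hdV : is_haar_U1 dV)
    (d : measure_display) (T : measurableType d) (P : probability T R)
    (DL DR : set nat) (xiL xiR : nat -> {RV P >-> R})
    (hxiL : forall n w, DL n -> 0 < xiL n w)
    (hxiR : forall n w, DR n -> 0 < xiR n w)
    (c : R[i]) (hc : c != 0)
    (hfin : forall jL jR : R,
      (\int[P]_w (detprod DL (xiL ^~ w) jL * detprod DR (xiR ^~ w) jR)
         < +oo)%E)
    (hZ : forall jL jR : R,
      ((- (jL * jR)) ^+ nu *
        fine (\int[P]_w
          (detprod DL (xiL ^~ w) jL * detprod DR (xiR ^~ w) jR))%E)%:C
      = c * Zeff dV nu V4 Phi jL jR) :
  (forall jL jR : R,
    Zeff dV nu V4 Phi jL jR =
    (besselI nu (- (2 * V4 * Phi * jL)) * besselI nu (2 * V4 * Phi * jR))%:C)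
  /\ (\int[P]_w sum_inv2 DR (xiR ^~ w) =
        ((V4 * Phi) ^+ 2 / nu.+1%:R)%:E)%E
  /\ (\int[P]_w sum_inv2 DL (xiL ^~ w) =
        ((V4 * Phi) ^+ 2 / nu.+1%:R)%:E)%E
  /\ (\int[P]_w (sum_inv2 DR (xiR ^~ w) * sum_inv2 DL (xiL ^~ w)) =
        ((V4 * Phi) ^+ 4 / nu.+1%:R ^+ 2)%:E)%E
  /\ (\int[P]_w sum_inv4 DR (xiR ^~ w) =
        ((V4 * Phi) ^+ 4 / (2 * nu.+1%:R * nu.+2%:R))%:E)%E
  /\ (\int[P]_w sum_inv4 DL (xiL ^~ w) =
        ((V4 * Phi) ^+ 4 / (2 * nu.+1%:R * nu.+2%:R))%:E)%E.
Proof.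
have ZE jL jR := @ZeffE R dV nu V4 Phi jL jR hdV.
split => //.
pose s n w := inv_sqr DL (xiL ^~ w) n; pose t n w := inv_sqr DR (xiR ^~ w) n.
have s0 n w : 0 <= s n w by exact: inv_sqr_ge0.
have t0 n w : 0 <= t n w by exact: inv_sqr_ge0.
have ms n : measurable_fun setT (s n) by exact/measurable_inv_sqr/measurable_funPT.
have mt n : measurable_fun setT (t n) by exact/measurable_inv_sqr/measurable_funPT.
pose G x y := (\int[P]_w (eprod1D (s ^~ w) x * eprod1D (t ^~ w) y))%E.
have GE jL jR : (\int[P]_w (detprod DL (xiL ^~ w) jL * detprod DR (xiR ^~ w) jR))%E
    = G (jL ^+ 2) (jR ^+ 2).
  by apply: eq_integral => w _; rewrite !detprodE.
have Gfin x y : 0 <= x -> 0 <= y -> (G x y < +oo)%E.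
  move=> x0 y0; have := hfin (Num.sqrt x) (Num.sqrt y).
  by rewrite GE !sqr_sqrtr.
have G0 x y : 0 <= x -> 0 <= y -> (0 <= G x y)%E.
  move=> x0 y0; apply: integral_ge0 => w _; apply: mule_ge0;
    by apply: (le_trans lee01); exact: eprod1D_ge1.
pose f x := besselI_red nu ((V4 * Phi) ^+ 2 * x).
(* The constant left once the leading powers of both Bessel functions are cancelled against the
   power of the sources. Only the real part of [c] enters, as the real parts of the two sides are
   compared. *)
pose K := complex.Re c * ((V4 * Phi) ^+ 2) ^+ nu / nu`!%:R ^+ 2.
have f_taylor x : 0 < x <= 1 ->
    `|f x - (1 + (V4 * Phi) ^+ 2 / nu.+1%:R * x +
      (V4 * Phi) ^+ 4 / (2 * nu.+1%:R * nu.+2%:R) * x ^+ 2)| <=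
    besselI_red nu ((V4 * Phi) ^+ 2) * x ^+ 3.
  move=> x01; have := besselI_red_taylor2 nu (sqr_ge0 (V4 * Phi)) x01.
  by rewrite -exprM.
have GK x y : 0 < x <= 1 -> 0 < y <= 1 -> G x y = (K * (f x * f y))%:E.
  move=> /andP[x0 _] /andP[y0 _].
  have Gxy : G x y \is a fin_num by rewrite ge0_fin_numE ?Gfin ?G0// ltW.
  rewrite -(fineK Gxy); congr EFin.
  set jL := Num.sqrt x; set jR := Num.sqrt y.
  have xE : jL ^+ 2 = x by rewrite sqr_sqrtr// ltW.
  have yE : jR ^+ 2 = y by rewrite sqr_sqrtr// ltW.
  (* Cancelling this power requires nonzero sources: for [nu > 0] the assumed identity is empty at a
     zero source, so the expansion uses only positive [x] and [y]. *)
  have jLR : (- (jL * jR)) ^+ nu != 0.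
    by rewrite expf_neq0// oppr_eq0 mulf_neq0// sqrtr_eq0 -ltNge.
  have := hZ jL jR; rewrite GE xE yE ZE => /(congr1 (@complex.Re R)).
  rewrite [LHS]/= (mulrC c) Re_real_mul => h.
  apply: (mulfI jLR); rewrite h !besselI_redE.
  have -> : - (2 * V4 * Phi * jL) / 2 = - (V4 * Phi * jL) by field.
  have -> : 2 * V4 * Phi * jR / 2 = V4 * Phi * jR by field.
  rewrite sqrrN.
  have -> : (V4 * Phi * jL) ^+ 2 = (V4 * Phi) ^+ 2 * x by rewrite exprMn xE.
  have -> : (V4 * Phi * jR) ^+ 2 = (V4 * Phi) ^+ 2 * y by rewrite exprMn yE.
  rewrite -/(f x) -/(f y) /K (exprMn nu (V4 * Phi) jR).
  have -> : (- (V4 * Phi * jL)) ^+ nu =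
      (V4 * Phi) ^+ nu * (- jL) ^+ nu by rewrite -exprMn mulrN.
  have -> : (- (jL * jR)) ^+ nu = (- jL) ^+ nu * jR ^+ nu.
    by rewrite -exprMn mulNr.
  rewrite -exprM mulnC exprM.
  by field; rewrite pnatr_eq0 -lt0n fact_gt0.
have [E1 F1 E2 F2 EF] := @esym_moments R d T P s t s0 t0 ms mt
  (Gfin 1 1 ler01 ler01) f K _ _ _ f_taylor GK.
split; first by rewrite -F1; apply: eq_integral => w _; exact: sum_inv2E.
split; first by rewrite -E1; apply: eq_integral => w _; exact: sum_inv2E.
split.
  transitivity (((V4 * Phi) ^+ 2 / nu.+1%:R) ^+ 2)%:E%E.
    by rewrite -EF; apply: eq_integral => w _; rewrite !sum_inv2E muleC.
  by rewrite expr_div_n -exprM.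
split; first by rewrite -F2; apply: eq_integral => w _; exact: sum_inv4E.
by rewrite -E2; apply: eq_integral => w _; exact: sum_inv4E.
Qed.
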